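(* $\mathrm{PSD}\setminus\mathrm{PRT[T,O]}\neq\emptyset$.
   Context: An indexed family is a sequence $\mathcal F=(F_n)_{n\in\mathbb N}$ of subsets of $\mathbb N$ that is uniformly computably enumerable; $F\in\mathcal F$ means $F=F_n$ for some $n$, and $\mathrm{mi}_{\mathcal F}(F)$ is the least $n$ with $F_n=F$. An enumeration of a nonempty set $A$ is an infinite sequence of elements of $A$ in which every element of $A$ occurs; $f\restriction n$ is its initial segment of length $n$, and $\mathrm{content}(\sigma)$ is the set of entries of a finite string $\sigma$. A learner is a partial computable function from finite strings of naturals to naturals; hypothesis $h$ is interpreted as $F_h$. PSD is the class of indexed families $\mathcal F$ for which there are a learner $M$ and a polynomial $p$ such that for every $F\in\mathcal F$ and every enumeration $f$ of $F$, there is $n$ with $|\mathrm{content}(f\restriction n)|<p(\mathrm{mi}_{\mathcal F}(F))$ such that $M(f\restriction j)=M(f\restriction n)$ for all $j\ge n$ and $F_{M(f\restriction n)}=F$. A teacher is a computable map $T$ on finite strings with $T(\sigma)$ a prefix of $T(\tau)$ whenever $\sigma$ is a prefix of $\tau$, and $\mathrm{content}(T(\sigma))\subseteq\mathrm{content}(\sigma)$. PRT[T,O] is the class of indexed families $\mathcal F$ for which there are a learner $M$ with a membership oracle for the target set, a teacher $T$ (with access to the oracle answers $M$ receives) and a polynomial $p$ such that for every $F\in\mathcal F$ and every enumeration $f$ of $F$, $M$, fed $T(f\restriction n)$ in place of $f\restriction n$, converges to an index $h$ with $F_h=F$ in fewer than $p(\mathrm{mi}_{\mathcal F}(F))$ computation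 steps of the learner, using at most $p(\mathrm{mi}_{\mathcal F}(F))$ oracle queries. *)

(* Defs.v *)
(* A concrete machine model (an oracle RAM with
   unit-cost addition/subtraction and indirect addressing) is used to make
   "partial computable", "computable", "uniformly c.e.", "membership oracle"
   and "number of computation steps" precise. *)
From mathcomp Require Import all_boot.

Set Implicit Arguments.
Unset Strict Implicit.
Unset Printing Implicit Defensive.

Inductive instr : Type :=
| ILoadC  (r c : nat)       (* R[r] := c *)
| IAdd    (r a b : nat)     (* R[r] := R[a] + R[b] *)
| ISub    (r a b : nat)     (* R[r] := R[a] - R[b] (truncated) *)
| ILoadI  (r a : nat)       (* R[r] := R[R[a]] *)
| IStoreI (a b : nat)       (* R[R[a]] := R[b] *)
| IJz     (r j : nat)       (* if R[r] = 0 then goto j *)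
| IQuery  (r a : nat)       (* R[r] := (R[a] \in oracle) ? 1 : 0 *)
| IHalt.

Definition program := seq instr.
Definition regs := nat -> nat.
Definition upd (R : regs) (r v : nat) : regs := fun i => if i == r then v else R i.

Inductive step (p : program) (O : nat -> Prop) :
  nat -> regs -> nat -> regs -> seq (nat * bool) -> Prop :=
| st_loadc pc R r c : nth IHalt p pc = ILoadC r c ->
    step p O pc R pc.+1 (upd R r c) [::]
| st_add pc R r a b : nth IHalt p pc = IAdd r a b ->
    step p O pc R pc.+1 (upd R r (R a + R b)) [::]
| st_sub pc R r a b : nth IHalt p pc = ISub r a b ->
    step p O pc R pc.+1 (upd R r (R a - R b)) [::]
| st_loadi pc R r a : nth IHalt p pc = ILoadI r a ->
    step p O pc R pc.+1 (upd R r (R (R a))) [::]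
| st_storei pc R a b : nth IHalt p pc = IStoreI a b ->
    step p O pc R pc.+1 (upd R (R a) (R b)) [::]
| st_jz_t pc R r j : nth IHalt p pc = IJz r j -> R r = 0 ->
    step p O pc R j R [::]
| st_jz_f pc R r j : nth IHalt p pc = IJz r j -> R r <> 0 ->
    step p O pc R pc.+1 R [::]
| st_query_t pc R r a : nth IHalt p pc = IQuery r a -> O (R a) ->
    step p O pc R pc.+1 (upd R r 1) [:: (R a, true)]
| st_query_f pc R r a : nth IHalt p pc = IQuery r a -> ~ O (R a) ->
    step p O pc R pc.+1 (upd R r 0) [:: (R a, false)].

(* exec p O pc R t qs Rf : from (pc,R) the machine halts after exactly t steps,
   having made the oracle queries qs, with final registers Rf.  The machine halts
   when the current instruction is IHalt (or pc is out of range). *)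
Inductive exec (p : program) (O : nat -> Prop) :
  nat -> regs -> nat -> seq (nat * bool) -> regs -> Prop :=
| ex_halt pc R : nth IHalt p pc = IHalt -> exec p O pc R 0 [::] R
| ex_step pc R pc' R' q t qs Rf :
    step p O pc R pc' R' q -> exec p O pc' R' t qs Rf ->
    exec p O pc R t.+1 (q ++ qs) Rf.

Definition init_regs (s : seq nat) : regs :=
  fun i => if i == 0 then size s else nth 0 s i.-1.

(* Output conventions: a number is R[0]; a string is R[1..R[0]]. *)
Definition output_seq (R : regs) : seq nat := mkseq (fun i => R i.+1) (R 0).

Definition run (p : program) (O : nat -> Prop) (s : seq nat) (t : nat)
  (qs : seq (nat * bool)) (Rf : regs) : Prop := exec p O 0 (init_regs s) t qs Rf.

Definition no_oracle : nat -> Prop := fun _ => False.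

Definition ifamily := nat -> nat -> Prop.  (* F n = the n-th set F_n *)

Definition same_set (A B : nat -> Prop) : Prop := forall x, A x <-> B x.

Definition indexed_family (F : ifamily) : Prop :=
  exists e : program, forall n x,
    F n x <-> exists t qs Rf, run e no_oracle [:: n; x] t qs Rf.

Definition min_index (F : ifamily) (k : nat) : Prop :=
  forall j, j < k -> ~ same_set (F j) (F k).

Definition enumeration (A : nat -> Prop) (f : nat -> nat) : Prop :=
  (forall n, A (f n)) /\ (forall x, A x -> exists n, f n = x).

Definition restr (f : nat -> nat) (n : nat) : seq nat := mkseq f n.

(* polynomials with natural coefficients (lowest degree first) *)
Definition peval (cs : seq nat) (n : nat) : nat := foldr (fun c acc => c + n * acc) 0 cs.

Definition learner_out (M : program) (s : seq nat) (h : nat) : Prop :=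
  exists t qs Rf, run M no_oracle s t qs Rf /\ Rf 0 = h.

Definition PSD (F : ifamily) : Prop :=
  exists (M : program) (cs : seq nat),
  forall k f, min_index F k -> enumeration (F k) f ->
  exists n h,
    size (undup (restr f n)) < peval cs k /\
    learner_out M (restr f n) h /\
    (forall j, n <= j -> learner_out M (restr f j) h) /\
    same_set (F h) (F k).

(* The teacher receives the current string sigma and the transcript tr of all
   oracle (query, answer) pairs the learner has received so far. *)
Definition encode_teacher_input (s : seq nat) (tr : seq (nat * bool)) : seq nat :=
  size s :: s ++ flatten [seq [:: q.1; nat_of_bool q.2] | q <- tr].

Definition teacher_out (T : program) (s : seq nat) (tr : seq (nat * bool))
  (u : seq nat) : Prop :=
  exists t qs Rf, run T no_oracle (encode_teacher_input s tr) t qs Rf /\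
                  output_seq Rf = u.

Definition teacher (T : program) : Prop :=
  (forall s tr, exists u, teacher_out T s tr u) /\
  (forall s s' tr tr' u u', prefix s s' -> prefix tr tr' ->
     teacher_out T s tr u -> teacher_out T s' tr' u' -> prefix u u') /\
  (forall s tr u, teacher_out T s tr u -> {subset u <= s}).

Definition oracle_learner_out (M : program) (A : nat -> Prop) (s : seq nat)
  (t : nat) (qs : seq (nat * bool)) (h : nat) : Prop :=
  exists Rf, run M A s t qs Rf /\ Rf 0 = h.

(* play M T A f n tr t s h : after stages 0..n of the interaction, the cumulative
   oracle transcript of the learner is tr, the cumulative number of learner
   computation steps is t, the teacher's current output is s = T(f|n) and the
   learner's current hypothesis is h = M(s).  The learner is (re)run only when
   the teacher's output changes. *)
Inductive play (M T : program) (A : nat -> Prop) (f : nat -> nat) :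
  nat -> seq (nat * bool) -> nat -> seq nat -> nat -> Prop :=
| play0 s t qs h :
    teacher_out T (restr f 0) [::] s ->
    oracle_learner_out M A s t qs h ->
    play M T A f 0 qs t s h
| play_same n tr t s h :
    play M T A f n tr t s h ->
    teacher_out T (restr f n.+1) tr s ->
    play M T A f n.+1 tr t s h
| play_new n tr t s h s' t' qs' h' :
    play M T A f n tr t s h ->
    teacher_out T (restr f n.+1) tr s' -> s' <> s ->
    oracle_learner_out M A s' t' qs' h' ->
    play M T A f n.+1 (tr ++ qs') (t + t') s' h'.

Definition PRT_TO (F : ifamily) : Prop :=
  exists (M T : program) (cs : seq nat),
  teacher T /\
  forall k f, min_index F k -> enumeration (F k) f ->
  exists n tr t s h,
    play M T (F k) f n tr t s h /\
    t < peval cs k /\ size tr <= peval cs k /\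
    same_set (F h) (F k) /\
    (forall j, n <= j -> exists tr' t' s', play M T (F k) f j tr' t' s' h).

(* Main.v *)
Require Import Defs.
From mathcomp Require Import all_boot zify.

Set Implicit Arguments.
Unset Strict Implicit.
Unset Printing Implicit Defensive.

(* The separating family is explicit and the lower bound is information
   theoretic: it does not use that the teacher is computable.

   A learner that makes [t] steps on a string of length [L] only handles numbers
   of the form [z * L + w] with [z] and [w] small, that is, numbers that are
   small or nearly as large as [L]; and the strings of a teacher never get
   shorter.  Every member of the family has at most three elements and is
   determined by its largest one, which gives PSD.  In a block [W, 2 ^ W) the
   family contains [{a}], and for each [v] the sets [{a, b}], [{a, b, b ^ 2}] and
   [{a, b, b ^ 3}] with [b] huge and rapidly increasing in [v]; the index of
   [{a}] is larger than all these elements, the index of [{a, b}] is larger than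
   [b], and the indices of the three-element sets are small and decrease with
   [v].

   Feed a learner the text a, a, a, ... of [{a}].  When it conjectures [{a}], the
   teacher's string is already too long for a cheap query of any [b], [b ^ 2],
   [b ^ 3] and for a cheap conjecture of [{a, b}].  Hence for every [v] one of
   [b], [b ^ 2], [b ^ 3] must have been queried before, and at a cost polynomial
   in the index of a set containing it: two sets share [b], so that one of them
   is not the current conjecture when the query is made.  But for the largest [b]
   this query comes within few steps and makes the string too long for the
   smaller ones; so those, more than there are steps, came earlier. *)

(** * Runs of the machine *)

Section Machine.
Variable p : program.

Inductive reach (O : nat -> Prop) :
  nat -> regs -> nat -> seq (nat * bool) -> nat -> regs -> Prop :=
| reach_refl pc R : reach O pc R 0 [::] pc R
| reach_step pc R pc1 R1 q t qs pc2 R2 :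
    step p O pc R pc1 R1 q -> reach O pc1 R1 t qs pc2 R2 ->
    reach O pc R t.+1 (q ++ qs) pc2 R2.

Lemma step_det O pc R pc1 R1 q1 pc2 R2 q2 :
  step p O pc R pc1 R1 q1 -> step p O pc R pc2 R2 q2 ->
  [/\ pc1 = pc2, R1 = R2 & q1 = q2].
Proof.
by case=> *; match goal with H : step _ _ _ _ _ _ _ |- _ => inversion H end;
  split; congruence.
Qed.

Lemma step_not_halt O pc R pc1 R1 q :
  step p O pc R pc1 R1 q -> nth IHalt p pc <> IHalt.
Proof. by case=> * ; congruence. Qed.

Lemma reach_trans O pc R t qs pc1 R1 t' qs' pc2 R2 :
  reach O pc R t qs pc1 R1 -> reach O pc1 R1 t' qs' pc2 R2 ->
  reach O pc R (t + t') (qs ++ qs') pc2 R2.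
Proof.
elim=> // {}pc {}R pc3 R3 q {}t {}qs {}pc1 {}R1 st _ IH /IH r.
by rewrite addSn -catA; apply: reach_step st r.
Qed.

Lemma reach_one O pc R pc1 R1 q :
  step p O pc R pc1 R1 q -> reach O pc R 1 q pc1 R1.
Proof. by move=> st; rewrite -[q]cats0; apply: reach_step st (reach_refl _ _ _). Qed.

Lemma execP O pc R t qs Rf :
  exec p O pc R t qs Rf <->
  exists2 pc', reach O pc R t qs pc' Rf & nth IHalt p pc' = IHalt.
Proof.
split=> [|[pc']].
  elim=> [{}pc {}R h|{}pc {}R pc1 R1 q {}t {}qs {}Rf st _ [pc' r h]].
    by exists pc => //; apply: reach_refl.
  by exists pc' => //; apply: reach_step st r.
elim=> [{}pc {}R h|{}pc {}R pc1 R1 q {}t {}qs pc2 R2 st _ IH /IH e].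
  exact: ex_halt.
exact: ex_step st e.
Qed.

Lemma exec_reach O pc R t qs pc1 R1 t' qs' Rf :
  reach O pc R t qs pc1 R1 -> exec p O pc R t' qs' Rf ->
  exists t1 qs1, t' = t + t1 /\ exec p O pc1 R1 t1 qs1 Rf.
Proof.
move=> r; elim: r t' qs' => [{}pc {}R|{}pc {}R pc2 R2 q {}t {}qs {}pc1 {}R1 st _ IH] t' qs' e.
  by exists t', qs'.
case: e st IH => [{}pc {}R h /step_not_halt //|].
move=> {}pc {}R pc' R' q' {}t' {}qs' {}Rf st' e st IH.
have [? ? _] := step_det st st'; subst pc' R'.
have [t1 [qs1 [-> e1]]] := IH _ _ e.
by exists t1, qs1; rewrite addSn.
Qed.

Lemma exec_det O pc R t qs Rf t' qs' Rf' :
  exec p O pc R t qs Rf -> exec p O pc R t' qs' Rf' ->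
  [/\ t = t', qs = qs' & Rf = Rf'].
Proof.
move=> e; elim: e t' qs' => [{}pc {}R h|{}pc {}R pc1 R1 q {}t {}qs {}Rf st _ IH] t' qs' e'.
  by inversion e'; subst => //; move/step_not_halt: H.
inversion e'; subst; first by move/step_not_halt: st.
have [? ? ?] := step_det st H; subst.
by have [-> -> ->] := IH _ _ H0.
Qed.

Definition agree_off (X : pred nat) (O O' : nat -> Prop) :=
  forall w, ~~ X w -> O w <-> O' w.

Definition avoids (X : pred nat) (qs : seq (nat * bool)) :=
  ~~ has X (unzip1 qs).

Lemma avoids_cat X qs qs' :
  avoids X (qs ++ qs') = avoids X qs && avoids X qs'.
Proof. by rewrite /avoids /unzip1 map_cat has_cat negb_or. Qed.

Lemma step_agree X O O' pc R pc1 R1 q :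
  agree_off X O O' -> step p O pc R pc1 R1 q -> avoids X q ->
  step p O' pc R pc1 R1 q.
Proof.
move=> ag; case=> {}pc {}R.
- by move=> *; apply: st_loadc.
- by move=> *; apply: st_add.
- by move=> *; apply: st_sub.
- by move=> *; apply: st_loadi.
- by move=> *; apply: st_storei.
- by move=> r j e R0 _; apply: st_jz_t e R0.
- by move=> r j e R0 _; apply: st_jz_f e R0.
- move=> r a e Oa; rewrite /avoids /= orbF => Xa.
  by apply: st_query_t e _; apply/ag.
- move=> r a e Oa; rewrite /avoids /= orbF => Xa.
  by apply: st_query_f e _; rewrite -ag.
Qed.

Lemma reach_agree X O O' pc R t qs pc1 R1 :
  agree_off X O O' -> reach O pc R t qs pc1 R1 -> avoids X qs ->
  reach O' pc R t qs pc1 R1.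
Proof.
move=> ag; elim=> [*|{}pc {}R pc2 R2 q {}t {}qs {}pc1 {}R1 st _ IH].
  exact: reach_refl.
rewrite avoids_cat => /andP[aq aqs].
exact: reach_step (step_agree ag st aq) (IH aqs).
Qed.

Lemma step_size O pc R pc1 R1 q : step p O pc R pc1 R1 q -> size q <= 1.
Proof. by case. Qed.

Lemma reach_size O pc R t qs pc1 R1 : reach O pc R t qs pc1 R1 -> size qs <= t.
Proof.
elim=> // {}pc {}R pc2 R2 q {}t {}qs {}pc1 {}R1 /step_size sq _ IH.
by rewrite size_cat; lia.
Qed.

(* The run is cut just before its first query in [X]; up to that point it does
   not depend on the oracle inside [X]. *)
Lemma exec_first_query X O pc R t qs Rf :
  exec p O pc R t qs Rf -> ~~ avoids X qs ->
  exists t1 qs1 pc1 R1 r a, [/\ reach O pc R t1 qs1 pc1 R1, avoids X qs1,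
    nth IHalt p pc1 = IQuery r a, X (R1 a) & R1 a \in unzip1 qs].
Proof.
elim=> [//|{}pc {}R pc2 R2 q {}t {}qs {}Rf st _ IH].
rewrite avoids_cat negb_and.
case aq: (avoids X q) => /=.
  move=> /IH[t1 [qs1 [pc1 [R1 [r [a [re av n Xa i]]]]]]].
  exists t1.+1, (q ++ qs1), pc1, R1, r, a; split=> //.
  - exact: reach_step st re.
  - by rewrite avoids_cat aq.
  - by rewrite /unzip1 map_cat mem_cat i orbT.
move=> _; have [r [a [n Xa i]]] : exists r a,
    [/\ nth IHalt p pc = IQuery r a, X (R a) & R a \in unzip1 q].
  move: aq; rewrite /avoids; case: st => // {}pc {}R r a n _ /=;
  by rewrite orbF => /negbFE Xa; exists r, a; split=> //; rewrite inE eqxx.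
exists 0, [::], pc, R, r, a; split=> //; first exact: reach_refl.
by rewrite /unzip1 map_cat mem_cat i.
Qed.

End Machine.

(* The values a program can hold after few steps: unit-cost additions and
   subtractions only produce small integer combinations of the length [L] of the
   input, its entries and the constants of the program. *)
Definition lincomb (L B t v : nat) : Prop :=
  exists an bn ap bp, [/\ v + an * L + bn = ap * L + bp,
    an <= 2 ^ t, ap <= 2 ^ t, bn <= 2 ^ t * B & bp <= 2 ^ t * B].

Lemma lincomb_le L B t t' v : t <= t' -> lincomb L B t v -> lincomb L B t' v.
Proof.
move=> le [an [bn [ap [bp [e h1 h2 h3 h4]]]]]; exists an, bn, ap, bp.
have le2 : 2 ^ t <= 2 ^ t' by rewrite leq_exp2l.
have leB : 2 ^ t * B <= 2 ^ t' * B by rewrite leq_mul2r le2 orbT.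
by split=> //; [exact: leq_trans h1 le2 | exact: leq_trans h2 le2
  | exact: leq_trans h3 leB | exact: leq_trans h4 leB].
Qed.

Lemma lincomb_small L B t v : v <= B -> lincomb L B t v.
Proof.
move=> le; exists 0, 0, 0, v; split=> //; first lia.
by rewrite (leq_trans le) // leq_pmull // expn_gt0.
Qed.

Lemma lincomb_add L B t v w :
  lincomb L B t v -> lincomb L B t w -> lincomb L B t.+1 (v + w).
Proof.
move=> [an [bn [ap [bp [e h1 h2 h3 h4]]]]] [an' [bn' [ap' [bp' [e' h1' h2' h3' h4']]]]].
exists (an + an'), (bn + bn'), (ap + ap'), (bp + bp').
by rewrite expnS mul2n -addnn !mulnDl; split; lia.
Qed.

Lemma lincomb_sub L B t v w :
  lincomb L B t v -> lincomb L B t w -> lincomb L B t.+1 (v - w).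
Proof.
case: (leqP v w) => [|/ltnW le]; first by rewrite -subn_eq0 => /eqP-> _ _; apply: lincomb_small.
move=> [an [bn [ap [bp [e h1 h2 h3 h4]]]]] [an' [bn' [ap' [bp' [e' h1' h2' h3' h4']]]]].
exists (an + ap'), (bn + bp'), (ap + an'), (bp + bn').
by rewrite expnS mul2n -addnn !mulnDl; split; lia.
Qed.

Lemma lincomb_upper L B t v : lincomb L B t v -> v <= 2 ^ t * (L + B).
Proof.
move=> [an [bn [ap [bp [e h1 h2 h3 h4]]]]]; rewrite mulnDr.
have : ap * L <= 2 ^ t * L by rewrite leq_mul2r h2 orbT.
lia.
Qed.

(** Compare the two coefficients of [L]: if the negative one is at least the positive one, only the
    constant part is left; otherwise a whole [L] survives. *)
Lemma lincomb_gap L B t v :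
  lincomb L B t v -> v <= 2 ^ t * B \/ L <= v + 2 ^ t * B.
Proof.
move=> [an [bn [ap [bp [e h1 h2 h3 h4]]]]].
case: (leqP ap an) => [le|lt]; [left|right].
  have : ap * L <= an * L by rewrite leq_mul2r le orbT.
  lia.
have : an.+1 * L <= ap * L by rewrite leq_mul2r lt orbT.
rewrite mulSn; lia.
Qed.

Definition instr_const (i : instr) : nat := if i is ILoadC _ c then c else 0.
(** The fold starts at [1] so that the query answers [0] and [1] obey the same bound as the
    constants. *)
Definition prog_const (p : program) : nat := foldr maxn 1 (map instr_const p).

Lemma prog_const_gt0 p : 0 < prog_const p.
Proof. by rewrite /prog_const; elim: p => //= i p IH; rewrite leq_max IH orbT. Qed.

Lemma instr_const_le p pc : instr_const (nth IHalt p pc) <= prog_const p.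
Proof.
elim: p pc => [|i p IH] [|pc] //=; rewrite /prog_const /= leq_max ?leqnn //.
by rewrite [X in _ || X]IH orbT.
Qed.

Lemma lincomb_step p O L B t pc R pc1 R1 q :
  prog_const p <= B -> step p O pc R pc1 R1 q ->
  (forall i, lincomb L B t (R i)) -> forall i, lincomb L B t.+1 (R1 i).
Proof.
move=> cB st lc; have lc' i : lincomb L B t.+1 (R i) by apply: lincomb_le (lc i).
have B0 : 0 < B by rewrite (leq_trans (prog_const_gt0 p)).
case: st lc lc' => // {}pc {}R r.
- move=> c e lc lc' i; rewrite /upd; case: eqP => // _; apply: lincomb_small.
  by have := instr_const_le p pc; rewrite e => /leq_trans; apply.
- by move=> a b e lc lc' i; rewrite /upd; case: eqP => // _; apply: lincomb_add.
- by move=> a b e lc lc' i; rewrite /upd; case: eqP => // _; apply: lincomb_sub.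
- by move=> a e lc lc' i; rewrite /upd; case: eqP.
- by move=> a e lc lc' i; rewrite /upd; case: eqP.
- by move=> a e _ lc lc' i; rewrite /upd; case: eqP => // _; apply: lincomb_small.
- by move=> a e _ lc lc' i; rewrite /upd; case: eqP => // _; apply: lincomb_small.
Qed.

Lemma lincomb_reach p O L B t0 pc R t qs pc1 R1 :
  prog_const p <= B -> reach p O pc R t qs pc1 R1 ->
  (forall i, lincomb L B t0 (R i)) -> forall i, lincomb L B (t0 + t) (R1 i).
Proof.
move=> cB r; elim: r t0 => [{}pc {}R|{}pc {}R pc2 R2 q {}t {}qs {}pc1 {}R1 st _ IH] t0 lc.
  by rewrite addn0.
by rewrite addnS -addSn; apply: IH; apply: lincomb_step cB st lc.
Qed.

Lemma lincomb_run p O s B t qs pc1 R1 :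
  prog_const p <= B -> (forall x, x \in s -> x <= B) ->
  reach p O 0 (init_regs s) t qs pc1 R1 ->
  forall i, lincomb (size s) B t (R1 i).
Proof.
move=> cB sB r; apply: (lincomb_reach (t0 := 0) cB r) => i.
rewrite /init_regs; case: eqP => _.
  by exists 0, 0, 1, 0; rewrite addn0 mul1n.
apply: lincomb_small; case: (ltnP i.-1 (size s)) => [lt|le].
  by apply/sB/mem_nth.
by rewrite nth_default.
Qed.

(** * Interaction of learner and teacher *)

Lemma restr_eq (f f' : nat -> nat) n :
  (forall j, j < n -> f j = f' j) -> restr f n = restr f' n.
Proof.
move=> ff'; apply/eq_in_map => j; rewrite mem_iota add0n => /andP[_]; exact: ff'.
Qed.

Lemma mem_restr (f : nat -> nat) n x : x \in restr f n -> exists2 j, j < n & x = f j.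
Proof. by move=> /mapP[j]; rewrite mem_iota add0n => /andP[_ jn] ->; exists j. Qed.

Lemma prefix_restr (f : nat -> nat) n : prefix (restr f n) (restr f n.+1).
Proof. by rewrite /restr mkseqS -cats1 prefix_prefix. Qed.

Lemma teacher_out_det T s tr u u' :
  teacher_out T s tr u -> teacher_out T s tr u' -> u = u'.
Proof.
move=> [t [qs [Rf [e <-]]]] [t' [qs' [Rf' [e' <-]]]].
by have [_ _ ->] := exec_det e e'.
Qed.

Lemma learner_run_det M A s t qs h t' qs' h' :
  oracle_learner_out M A s t qs h -> oracle_learner_out M A s t' qs' h' ->
  [/\ t = t', qs = qs' & h = h'].
Proof.
move=> [Rf [e <-]] [Rf' [e' <-]].
by have [-> -> ->] := exec_det e e'.
Qed.

Lemma learner_run_agree M A A' X s t qs h :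
  agree_off X A A' -> avoids X qs ->
  oracle_learner_out M A s t qs h -> oracle_learner_out M A' s t qs h.
Proof.
move=> ag av [Rf [/execP[pc r hl] <-]]; exists Rf; split=> //.
by apply/execP; exists pc => //; apply: reach_agree ag r av.
Qed.

Lemma learner_run_size M A s t qs h :
  oracle_learner_out M A s t qs h -> size qs <= t.
Proof. by move=> [Rf [/execP[pc /reach_size]]]. Qed.

Lemma learner_run_lincomb M A B s t qs h :
  prog_const M <= B -> (forall x, x \in s -> x <= B) ->
  oracle_learner_out M A s t qs h -> lincomb (size s) B t h.
Proof. by move=> cB sB [Rf [/execP[pc r _] <-]]; apply: lincomb_run r _. Qed.

Section Play.
Variables (M T : program).
Hypothesis tT : teacher T.

Section Target.
Variables (A : nat -> Prop) (f : nat -> nat).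
Local Notation play := (play M T A f).

Lemma play_det n tr t s h tr' t' s' h' :
  play n tr t s h -> play n tr' t' s' h' ->
  [/\ tr = tr', t = t', s = s' & h = h'].
Proof.
move=> p1; elim: p1 tr' t' s' h'
  => [{}s {}t qs {}h to lo|{}n {}tr {}t {}s {}h p IH to
     |{}n {}tr {}t {}s {}h s1 t1 qs1 h1 p IH to ne lo] tr' t' s' h' p'.
- inversion p' as [s2 t2 qs2 h2 to2 lo2| |]; subst.
  have es := teacher_out_det to to2; subst.
  by have [-> -> ->] := learner_run_det lo lo2.
- inversion p' as [|n2 tr2 t2 s2 h2 p2 to2|n2 tr2 t2 s2 h2 s3 t3 qs3 h3 p2 to2 ne2 lo2]; subst.
    exact: IH p2.
  have [? ? ? ?] := IH _ _ _ _ p2; subst.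
  by have := teacher_out_det to to2 => /esym.
- inversion p' as [|n2 tr2 t2 s2 h2 p2 to2|n2 tr2 t2 s2 h2 s3 t3 qs3 h3 p2 to2 ne2 lo2]; subst.
    have [? ? ? ?] := IH _ _ _ _ p2; subst.
    by have := teacher_out_det to to2.
  have [? ? ? ?] := IH _ _ _ _ p2; subst.
  have es := teacher_out_det to to2; subst.
  by have [-> -> ->] := learner_run_det lo lo2.
Qed.

(** The teacher produces [s] before the learner runs on it, so the transcript it saw may be a proper
    prefix of the current one. *)
Lemma play_teacher n tr t s h : play n tr t s h ->
  exists2 tr0, prefix tr0 tr & teacher_out T (restr f n) tr0 s.
Proof.
case=> [{}s {}t qs {}h to _|{}n {}tr {}t {}s {}h _ to
  |{}n {}tr {}t {}s {}h s1 t1 qs1 h1 _ to _ _].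
- by exists [::] => //; rewrite prefix0s.
- by exists tr; rewrite ?prefix_refl.
- by exists tr; rewrite ?prefix_prefix.
Qed.

Lemma play_subset n tr t s h : play n tr t s h -> {subset s <= restr f n}.
Proof. by move=> /play_teacher[tr0 _]; case: tT => _ [_]; apply. Qed.

Lemma play_size n tr t s h : play n tr t s h -> size tr <= t.
Proof.
elim=> [{}s {}t qs {}h _ /learner_run_size //|//|].
move=> {}n {}tr {}t {}s {}h s1 t1 qs1 h1 _ IH _ _ /learner_run_size.
rewrite size_cat; lia.
Qed.

Lemma play_next n tr t s h tr' s' :
  play n tr t s h -> teacher_out T (restr f n.+1) tr' s' -> prefix tr tr' ->
  prefix s s'.
Proof.
move=> /play_teacher[tr0 pr to] to' pr'; case: tT => _ [mono _].
by apply: mono to to'; [exact: prefix_restr | exact: prefix_trans pr pr'].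
Qed.

Lemma play_before n tr t s h m : play n tr t s h -> m <= n ->
  exists tr' t' s' h', [/\ play m tr' t' s' h', prefix tr' tr, t' <= t & prefix s' s].
Proof.
move=> p; elim: p m => [{}s {}t qs {}h to lo|{}n {}tr {}t {}s {}h p IH to
     |{}n {}tr {}t {}s {}h s1 t1 qs1 h1 p IH to ne lo] m.
- rewrite leqn0 => /eqP ->; exists qs, t, s, h.
  by split=> //; [exact: play0 to lo | exact: prefix_refl | exact: prefix_refl].
- rewrite leq_eqVlt => /orP[/eqP->|]; last exact: IH.
  exists tr, t, s, h.
  by split=> //; [exact: play_same p to | exact: prefix_refl | exact: prefix_refl].
- rewrite leq_eqVlt => /orP[/eqP->|].
    exists (tr ++ qs1), (t + t1), s1, h1.
    by split=> //; [exact: play_new p to ne lo | exact: prefix_refl | exact: prefix_refl].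
  move=> /IH[tr' [t' [s' [h' [p' pr le ps]]]]]; exists tr', t', s', h'; split=> //.
  + exact: prefix_trans pr (prefix_prefix _ _).
  + lia.
  + exact: prefix_trans ps (play_next p to (prefix_refl _)).
Qed.

Lemma play_mono m n tr' t' s' h' tr t s h :
  play m tr' t' s' h' -> play n tr t s h -> m <= n ->
  [/\ prefix tr' tr, t' <= t & size s' <= size s].
Proof.
move=> p' p /(play_before p)[tr2 [t2 [s2 [h2 [p2 pr le ps]]]]].
have [-> -> -> _] := play_det p' p2.
by split=> //; apply: size_prefix.
Qed.

(** The hypothesis comes from the latest run, made on the current string [s], whose entries are
    data; the cumulative cost bounds the cost of that run. *)
Lemma play_lincomb n tr t s h B :
  prog_const M <= B -> (forall j, f j <= B) ->
  play n tr t s h -> lincomb (size s) B t h.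
Proof.
move=> cB fB p; have: forall x, x \in s -> x <= B.
  by move=> x /(play_subset p)/mem_restr[j _ ->].
elim: p => [{}s {}t qs {}h to lo sB|//|].
  exact: learner_run_lincomb lo.
move=> {}n {}tr {}t {}s {}h s1 t1 qs1 h1 p IH to ne lo sB.
by apply: lincomb_le (learner_run_lincomb cB sB lo); rewrite leq_addl.
Qed.

End Target.

(** The target enters a play only through the answers to queries, and the text only through its
    first [n] entries. *)
Lemma play_agree A A' f f' X n tr t s h :
  agree_off X A A' -> (forall j, j < n -> f j = f' j) -> avoids X tr ->
  play M T A f n tr t s h -> play M T A' f' n tr t s h.
Proof.
move=> ag ff' av p; elim: p ff' av => [{}s {}t qs {}h to lo|{}n {}tr {}t {}s {}h p IH to
     |{}n {}tr {}t {}s {}h s1 t1 qs1 h1 p IH to ne lo] ff' av.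
- by apply: play0 (learner_run_agree ag av lo).
- apply: play_same; first by apply: IH => // j jn; apply: ff'; lia.
  by rewrite -(restr_eq ff').
- move: av; rewrite avoids_cat => /andP[av av1].
  apply: (play_new (s := s)) => //.
  + by apply: IH => // j jn; apply: ff'; lia.
  + by rewrite -(restr_eq ff').
  + exact: learner_run_agree ag av1 lo.
Qed.

(* [q] is the first queried element of [X] and [tau] the cost spent before that
   query; every play whose target agrees with [A] outside [X] and whose text
   agrees with [f] before stage [m] also makes this query. *)
Record first_query (A : nat -> Prop) (f : nat -> nat) (X : pred nat) (m : nat)
    (q tau : nat) (tr0 tr : seq (nat * bool)) (t : nat) (s : seq nat) (h : nat)
    : Prop := FirstQuery {
  fq_play : play M T A f m tr t s h;
  fq_in : q \in unzip1 tr;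
  fq_X : X q;
  fq_lincomb : forall B, prog_const M <= B -> (forall j, f j <= B) ->
    lincomb (size s) B tau q;
  fq_before : size tr0 <= tau;
  fq_avoids : avoids X tr0;
  fq_prefix : forall m' tr' t' s' h', m' < m -> play M T A f m' tr' t' s' h' ->
    prefix tr' tr0;
  fq_cost : forall A' f' tr' t' s' h', agree_off X A A' ->
    (forall j, j < m -> f j = f' j) -> play M T A' f' m tr' t' s' h' -> tau < t' }.

(** Up to the query the run is the same for both oracles, and the query itself costs one more
    step. *)
Lemma exec_query_cost p A A' X pc R t1 qs1 pc1 R1 r a t qs Rf :
  agree_off X A A' -> reach p A pc R t1 qs1 pc1 R1 -> avoids X qs1 ->
  nth IHalt p pc1 = IQuery r a -> exec p A' pc R t qs Rf -> t1 < t.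
Proof.
move=> ag re av n1 e; have [t2 [qs2 [-> e2]]] := exec_reach (reach_agree ag re av) e.
by inversion e2; [congruence | lia].
Qed.

Lemma exists_first_query A f X n tr t s h :
  play M T A f n tr t s h -> ~~ avoids X tr ->
  exists m q tau tr0 tr' t' s' h',
    m <= n /\ first_query A f X m q tau tr0 tr' t' s' h'.
Proof.
elim=> [{}s {}t qs {}h to lo|{}n {}tr {}t {}s {}h p IH to
     |{}n {}tr {}t {}s {}h s1 t1 qs1 h1 p IH to ne lo] av.
- have [Rf [e eh]] := lo; have p0 := play0 to lo.
  have [tau [qs1 [pc1 [R1 [r [a [re av1 n1 Xa ia]]]]]]] := exec_first_query e av.
  exists 0, (R1 a), tau, qs1, qs, t, s, h; split=> //; split=> //.
  + move=> B cB fB; apply: (lincomb_run cB _ re).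
    by move=> x /(play_subset p0)/mem_restr[j _ ->].
  + exact: reach_size re.
  + move=> A' f' tr' t' s' h' ag _ p'.
    inversion p' as [s2 t2 qs2 h2 to2 lo2| |]; subst.
    have es := teacher_out_det to to2; subst.
    have [Rf' [e' _]] := lo2; exact: exec_query_cost ag re av1 n1 e'.
- by have [m [q [tau [tr0 [tr' [t' [s' [h' [mn fq]]]]]]]]] := IH av;
     exists m, q, tau, tr0, tr', t', s', h'; split=> //; lia.
(* Either an earlier stage already queried [X], or the first such query lies in the run on [s1],
   after the [t] steps of the former runs. *)
- case avt: (avoids X tr); last first.
    have [m [q [tau [tr0 [tr' [t' [s' [h' [mn fq]]]]]]]]] := IH (negbT avt).
    by exists m, q, tau, tr0, tr', t', s', h'; split=> //; lia.
  move: av; rewrite avoids_cat avt /= => av.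
  have [Rf [e eh]] := lo; have p1 := play_new p to ne lo.
  have [tau [qs2 [pc1 [R1 [r [a [re av1 n1 Xa ia]]]]]]] := exec_first_query e av.
  exists n.+1, (R1 a), (t + tau), (tr ++ qs2), (tr ++ qs1), (t + t1), s1, h1.
  split=> //; split=> //.
  + by rewrite /unzip1 map_cat mem_cat ia orbT.
  + move=> B cB fB; apply: lincomb_le (leq_addl t tau) _; apply: (lincomb_run cB _ re).
    by move=> x /(play_subset p1)/mem_restr[j _ ->].
  + by rewrite size_cat leq_add // ?(play_size p) // (reach_size re).
  + by rewrite avoids_cat avt av1.
  + move=> m' tr' t' s' h' mn p'.
    have [pr _ _] := play_mono p' p mn; exact: prefix_trans pr (prefix_prefix _ _).
  + move=> A' f' tr' t' s' h' ag ff' p'.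
    have pn : play M T A' f' n tr t s h.
      by apply: play_agree ag _ avt p => j jn; apply: ff'; lia.
    (* The other play is in the same state at stage [n], so the teacher again changes its output to
       [s1] and the learner is rerun. *)
    inversion p' as [|n2 tr2 t2 s2 h2 p2 to2
      |n2 tr2 t2 s2 h2 s3 t3 qs3 h3 p2 to2 ne2 lo2]; subst;
      have [? ? ? ?] := play_det pn p2; subst; rewrite -(restr_eq ff') in to2.
      by have := teacher_out_det to to2.
    have es := teacher_out_det to to2; subst.
    have [Rf' [e' _]] := lo2; rewrite ltn_add2l.
    exact: exec_query_cost ag re av1 n1 e'.
Qed.

End Play.

(** * The family *)

Definition dexp v := 2 ^ 2 ^ v.
Definition texp v := 2 ^ dexp v.

(* The largest number of the tower 0, 1, 2, 4, 16, ... that is at most [v]; the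
   numbers with the same base form a block [W, 2 ^ W). *)
Fixpoint base v :=
  if v is v'.+1 then if v == 2 ^ base v' then v else base v' else 0.

(** This is [texp v] to the power [j.+1], the largest element of [elts v j]. For [j = 0] it repeats
    [texp v]; if moreover [v = base v], a singleton remains. *)
Definition top v j := 2 ^ (j.+1 * dexp v).
Definition elts v j := [:: texp (base v); texp v; top v j].
(* The index of [{texp (base v)}] exceeds everything else in its block, the index
   of [{texp (base v), texp v}] exceeds [texp v], and the indices of the
   three-element sets lie in [3 * W, 3 * 2 ^ W + 2] and decrease with [v]. *)
Definition uexp v := if v == base v then (2 ^ base v).+1 else v.+1.
Definition idx v j :=
  3 * (if j == 0 then texp (uexp v) else base v + 2 ^ base v - v) + j.
(** The value [v = 0] is excluded because [top 0 1 = top 1 0]: the largest element would not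
    determine the set. *)
Definition fam : ifamily := fun n x =>
  exists v j, [/\ 0 < v, j < 3, n = idx v j & x \in elts v j].

Lemma leq_exp2 m n : m <= n -> 2 ^ m <= 2 ^ n.
Proof. by rewrite leq_exp2l. Qed.

Lemma dexpS v : dexp v.+1 = dexp v * dexp v.
Proof. by rewrite /dexp expnS mul2n -addnn expnD. Qed.

Lemma leq_dexp v w : v <= w -> dexp v <= dexp w.
Proof. by move=> ?; rewrite !leq_exp2. Qed.

Lemma leq_texp v w : v <= w -> texp v <= texp w.
Proof. by move=> ?; rewrite !leq_exp2. Qed.

Lemma dexp_gt1 v : 1 < dexp v.
Proof. by rewrite -[1](expn0 2) ltn_exp2l // expn_gt0. Qed.

Lemma texp_inj v w : texp v = texp w -> v = w.
Proof. by move=> /eqP; rewrite !eqn_exp2l // => /eqP. Qed.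

Lemma base_bounds v : base v <= v < 2 ^ base v.
Proof.
elim: v => //= v /andP[lo hi]; case: eqP => [_|/eqP ne].
  by rewrite leqnn ltn_expl.
by rewrite (leq_trans lo) //= ltn_neqAle ne.
Qed.

Lemma base_tower W v : base W = W -> W <= v < 2 ^ W -> base v = W.
Proof.
move=> bW; elim: v => [|v IH]; first by rewrite leqn0 => /andP[/eqP-> _].
rewrite leq_eqVlt => /andP[/orP[/eqP <- //|le] lt].
have bv : base v = W by apply: IH; rewrite -ltnS le /= ltnW.
by rewrite /= bv; case: eqP lt => // ->; rewrite ltnn.
Qed.

Lemma base_exp W : base W = W -> base (2 ^ W) = 2 ^ W.
Proof.
move=> bW; case e: (2 ^ W) => [|n]; first by have := expn_gt0 2 W; rewrite e.
have bn : base n = W by apply: base_tower => //; have := ltn_expl W (ltnSn 1); lia.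
by rewrite /= bn e eqxx.
Qed.

Lemma base_base v : base (base v) = base v.
Proof.
elim: v => // v IH.
rewrite (_ : base v.+1 = if v.+1 == 2 ^ base v then v.+1 else base v) //.
by case: eqP => [->|//]; apply: base_exp.
Qed.

Lemma tower_above N : exists2 W, N <= W & base W = W.
Proof.
elim: N => [|N [W NW bW]]; first by exists 0.
by exists (2 ^ W); [apply: leq_ltn_trans NW (ltn_expl _ _) | exact: base_exp].
Qed.

Lemma base_lt v w : base v < base w -> 2 ^ base v <= base w.
Proof.
move=> lt; rewrite leqNgt; apply/negP => lt2.
have := @base_tower (base v) (base w) (base_base v).
by rewrite base_base (ltnW lt) lt2 => /(_ isT) e; rewrite e ltnn in lt.
Qed.

(** The residue modulo 3 is [j]. [uexp] sends the base [W] of a block to [2 ^ W + 1], the value that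
    the next base would get from [v.+1]. The map [W + 2 ^ W - v] reflects the block into the numbers
    from [W + 1] to [2 ^ W], and these ranges are disjoint. *)
Lemma idx_inj v j v' j' :
  j < 3 -> j' < 3 -> idx v j = idx v' j' -> v = v' /\ j = j'.
Proof.
rewrite /idx => j3 j3' e; have ej : j = j' by lia.
subst j'; split=> //; have {e} :
  (if j == 0 then texp (uexp v) else base v + 2 ^ base v - v) =
  (if j == 0 then texp (uexp v') else base v' + 2 ^ base v' - v') by lia.
have := base_bounds v; have := base_bounds v'; case: eqP => _ bv' bv.
  move=> /texp_inj; rewrite /uexp; case: eqP => [ev|ne]; case: eqP => [ev'|ne'].
  - by move=> /eqP; rewrite eqSS eqn_exp2l // => /eqP; rewrite -ev -ev'.
  - move=> [e]; case: ne'; rewrite -e -ev; symmetry; apply: base_exp.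
    by rewrite -ev.
  - move=> [e]; case: ne; rewrite e -ev'; symmetry; apply: base_exp.
    by rewrite -ev'.
  - by case.
case: (ltngtP (base v) (base v')) => [/base_lt|/base_lt|->]; lia.
Qed.

(* Recovers [v] from [texp v], [texp v ^ 2] and [texp v ^ 3]. *)
Definition rank q := trunc_log 2 (trunc_log 2 (trunc_log 2 q)).

(** The truncated logarithm of [j.+1 * dexp v] is [2 ^ v] or [2 ^ v + 1]; for positive [v] the
    latter is still below [2 ^ v.+1]. *)
Lemma rank_top v j : 0 < v -> j < 3 -> rank (top v j) = v.
Proof.
move=> v0 j3; rewrite /rank /top trunc_expnK //.
have -> : trunc_log 2 (j.+1 * dexp v) = 2 ^ v + (0 < j).
  apply: trunc_log_eq => //; rewrite /dexp expnS expnD.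
  by case: j j3 => [|[|[|]]] //= _; have := dexp_gt1 v; rewrite /dexp; lia.
apply: trunc_log_eq => //; rewrite expnS; have := leq_exp2 v0; case: j {j3}=> *; lia.
Qed.

Lemma top_inj v j v' j' : 0 < v -> 0 < v' -> j < 3 -> j' < 3 ->
  top v j = top v' j' -> v = v' /\ j = j'.
Proof.
move=> v0 v0' j3 j3' e; have ev : v = v' by rewrite -(rank_top v0 j3) e rank_top.
subst v'; split=> //; move/eqP: e; rewrite eqn_exp2l // eqn_pmul2r.
  by move=> /eqP[].
by rewrite ltnW // dexp_gt1.
Qed.

Lemma texp_top v : texp v = top v 0.
Proof. by rewrite /top mul1n. Qed.

Lemma leq_top v j j' : j <= j' -> top v j <= top v j'.
Proof. by move=> le; rewrite leq_exp2 // leq_mul2r ltnS le orbT. Qed.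

Lemma elts_le_top v j x : x \in elts v j -> x <= top v j.
Proof.
rewrite !inE => /or3P[] /eqP-> //; last by rewrite texp_top leq_top.
apply: leq_trans (_ : texp v <= _); last by rewrite texp_top leq_top.
by case/andP: (base_bounds v) => le _; rewrite leq_texp.
Qed.

Lemma fam_idx v j x : 0 < v -> j < 3 -> fam (idx v j) x <-> x \in elts v j.
Proof.
move=> v0 j3; split=> [[v' [j' [v0' j3' /idx_inj[] // -> ->]]] //|xe].
by exists v, j.
Qed.

Lemma top_elts v j : top v j \in elts v j.
Proof. by rewrite !inE eqxx !orbT. Qed.

(** Equal sets have equal largest elements, which determine [v] and [j]. So a nonempty member has
    only one index, and a correct hypothesis is exactly that index. *)
Lemma fam_same v j h : 0 < v -> j < 3 ->
  same_set (fam h) (fam (idx v j)) -> h = idx v j.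
Proof.
move=> v0 j3 ss.
have /ss[v' [j' [v0' j3' eh le]]] : fam (idx v j) (top v j) by apply/fam_idx/top_elts.
have : fam h (top v' j') by rewrite eh; apply/fam_idx/top_elts.
move=> /ss/(fam_idx _ v0 j3)/elts_le_top le'.
have /top_inj[] // : top v j = top v' j' by apply/eqP; rewrite eqn_leq le' elts_le_top.
by rewrite eh => -> ->.
Qed.

Lemma min_index_idx v j : 0 < v -> j < 3 -> min_index fam (idx v j).
Proof. by move=> v0 j3 i lt /fam_same e; rewrite e // ltnn in lt. Qed.

(** * Polynomial growth and the choice of a block *)

Lemma leq_peval cs m n : m <= n -> peval cs m <= peval cs n.
Proof. by move=> le; elim: cs => //= c cs IH; rewrite leq_add2l leq_mul. Qed.

(** Quantifying over all powers of [f] makes the notion closed under products and sums, hence under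
    polynomials. *)
Definition slow (f : nat -> nat) :=
  forall m, exists N, forall y, N <= y -> f y ^ m <= 2 ^ y.

Lemma slow_const c : slow (fun=> c).
Proof.
move=> m; exists (c ^ m) => y le.
exact: leq_trans le (ltnW (ltn_expl _ _)).
Qed.

Lemma slow_mul f g : slow f -> slow g -> slow (fun y => f y * g y).
Proof.
move=> sf sg m; have [Nf hf] := sf (m * 2); have [Ng hg] := sg (m * 2).
exists (maxn Nf Ng) => y; rewrite geq_max => /andP[/hf f2 /hg g2].
(* After squaring, each factor contributes one [2 ^ y]. *)
rewrite -(@leq_exp2r _ _ 2) // -expnM expnMn.
by rewrite expnS expn1; apply: leq_mul.
Qed.

Lemma slow_le f g : (forall y, f y <= g y) -> slow g -> slow f.
Proof.
move=> fg sg m; have [N h] := sg m; exists N => y /h.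
by apply: leq_trans; case: m {h} => // m; rewrite leq_exp2r.
Qed.

(** Sums reduce to products by [f + g <= f.+1 * g.+1], and [h.+1] is at most the larger of [2] and
    [h * 2]. *)
Lemma slow_add f g : slow f -> slow g -> slow (fun y => f y + g y).
Proof.
have slowS h : slow h -> slow (fun y => (h y).+1).
  move=> sh m; have [N1 h1] := slow_const 2 (m * 2); have [N2 h2] := sh (m * 2).
  exists (maxn N1 N2) => y; rewrite geq_max => /andP[/h1 f2 /h2 g2].
  have le : (h y).+1 <= maxn 2 (h y * 2) by lia.
  rewrite -(@leq_exp2r _ _ 2) // -expnM.
  apply: leq_trans (_ : maxn 2 (h y * 2) ^ (m * 2) <= _).
    by case: (m * 2) => // k; rewrite leq_exp2r.
  rewrite expnS expn1; case: (leqP 2 (h y * 2)) => _; last first.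
    by rewrite -[X in X <= _]muln1 leq_mul // expn_gt0.
  by rewrite expnMn leq_mul.
move=> sf sg; apply: slow_le (slow_mul (slowS _ sf) (slowS _ sg)) => y; lia.
Qed.

(** With [q = y %/ m.+1] large, [y <= m.+1 * q.+1 <= 2 ^ q]; now raise to the power [m.+1]. *)
Lemma slow_id : slow id.
Proof.
case=> [|m]; first by exists 0 => y _; rewrite expn0 expn_gt0.
have lin k q : q = m.+1.*2.+1 + k -> m.+1 * q.+1 <= 2 ^ q.
  move=> ->; elim: k => [|k IH]; last by rewrite addnS expnS; lia.
  rewrite addn0 expnS -addnn expnD; have := ltn_expl m.+1 (ltnSn 1).
  by move=> lt; have := leq_mul lt lt; lia.
exists (m.+1 * m.+1.*2.+1) => y le; set q := y %/ m.+1.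
have leq : m.+1.*2.+1 <= q by rewrite leq_divRL // mulnC.
have yq : y <= m.+1 * q.+1 by rewrite mulnC ltnW // ltn_ceil.
apply: leq_trans (_ : (2 ^ q) ^ m.+1 <= _).
  rewrite leq_exp2r // (leq_trans yq) //; by apply: (lin (q - m.+1.*2.+1)); rewrite subnKC.
by rewrite -expnM leq_exp2 // leq_divM.
Qed.

Lemma slow_peval cs f : slow f -> slow (fun y => peval cs (f y)).
Proof.
move=> sf; elim: cs => [|c cs IH] /=; first exact: slow_const.
by apply: slow_add; [exact: slow_const | exact: slow_mul].
Qed.

Lemma slow_bound f : slow f -> exists N, forall y, N <= y -> f y <= 2 ^ y.
Proof. by move=> /(_ 1)[N h]; exists N => y /h; rewrite expn1. Qed.

(** [3 * 2 ^ W + 2] bounds the indices of the three-element sets used in the block, and [3 * W + 5]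
    is the smallest index with [j = 2], attained at [v = 2 ^ W - 1]. The last inequality makes the
    block contain more values [v] than the cost at that index. *)
Lemma good_tower cs C : exists W, [/\ base W = W, 1 < W, C <= texp W,
  peval cs (3 * 2 ^ W + 2) + 3 <= dexp W & peval cs (3 * W + 5) + W + 3 <= 2 ^ W].
Proof.
have sl k c : slow (fun y => k * y + c).
  by apply: slow_add (slow_const c); apply: slow_mul slow_id; exact: slow_const.
have [N1 h1] := slow_bound (slow_add (slow_peval cs (sl 3 2)) (slow_const 3)).
have [N2 h2] := slow_bound
  (slow_add (slow_add (slow_peval cs (sl 3 5)) slow_id) (slow_const 3)).
have [W] := tower_above (maxn 2 (maxn C (maxn N1 N2))).
rewrite !geq_max => /and4P[W1 CW NW1 NW2] bW; have W2 := ltn_expl W (ltnSn 1).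
exists W; split=> //; first 2 last.
- exact: h2.
- have X2 := ltn_expl (2 ^ W) (ltnSn 1); have := ltn_expl (dexp W) (ltnSn 1).
  rewrite -/(dexp W) in X2; rewrite /texp; lia.
- by apply: h1; lia.
Qed.

(** * No learner with teacher and oracle *)

Definition continue (f : nat -> nat) n (l : seq nat) : nat -> nat :=
  fun i => if i < n then f i else nth 0 l ((i - n) %% size l).

Lemma continue_lt f n l i : i < n -> f i = continue f n l i.
Proof. by rewrite /continue => ->. Qed.

Lemma continue_enum f n l : 0 < size l -> (forall i, f i \in l) ->
  enumeration (fun x => x \in l) (continue f n l).
Proof.
move=> l0 fl; split=> [i|x xl]; rewrite /continue.
  by case: ifP => // _; rewrite mem_nth // ltn_mod.
exists (n + index x l); rewrite ltnNge leq_addr /= addKn modn_small ?nth_index //.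
by rewrite index_mem.
Qed.

Lemma enumeration_same (A B : nat -> Prop) f :
  same_set A B -> enumeration A f -> enumeration B f.
Proof. by move=> AB [fA Af]; split=> [n|x /AB/Af //]; apply/AB. Qed.

(** Excludes short inputs: if [L] and [B] are at most [2 ^ z], values after [t] steps are at most
    [2 ^ (t + z + 1)]. *)
Lemma long_input k t L B z :
  2 ^ k <= 2 ^ t * (L + B) -> L <= 2 ^ z -> B <= 2 ^ z -> t + z + 1 < k -> False.
Proof.
move=> le Lz Bz; apply/negP; rewrite -leqNgt -(@leq_exp2l 2) //.
apply: leq_trans le _; rewrite -addnA expnD leq_mul2l addn1 expnS; lia.
Qed.

Section LowerBound.
Variables (M T : program) (cs : seq nat).
Hypothesis tT : teacher T.
Hypothesis learns : forall k f, min_index fam k -> enumeration (fam k) f ->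
  exists n tr t s h,
    play M T (fam k) f n tr t s h /\
    t < peval cs k /\ size tr <= peval cs k /\
    same_set (fam h) (fam k) /\
    (forall j, n <= j -> exists tr' t' s', play M T (fam k) f j tr' t' s' h).

Local Notation p := (peval cs).

Lemma converges v j f : 0 < v -> j < 3 -> enumeration (fun x => x \in elts v j) f ->
  exists n, (exists tr t s, play M T (fam (idx v j)) f n tr t s (idx v j)
                            /\ t < p (idx v j)) /\
    forall m, n <= m -> exists tr t s, play M T (fam (idx v j)) f m tr t s (idx v j).
Proof.
move=> v0 j3 fe; have fe' : enumeration (fam (idx v j)) f.
  by apply: enumeration_same fe => x; split=> /(fam_idx x v0 j3).
have [n [tr [t [s [h [pl [tp [_ [/(fam_same v0 j3) eh al]]]]]]]]] :=
  learns (min_index_idx v0 j3) fe'.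
by subst h; exists n; split=> //; exists tr, t, s.
Qed.

Section OneTarget.
Variables (A : nat -> Prop) (f : nat -> nat) (Z : pred nat) (v : nat).
Hypotheses (v0 : 0 < v) (f_elts : forall i, f i \in [:: texp (base v); texp v]).

Let f_in j i : f i \in elts v j.
Proof. by have := f_elts i; rewrite !inE => /orP[] ->; rewrite ?orbT. Qed.

(** Continuing the text to an enumeration of [fam (idx v j)] leaves the play unchanged. Its
    hypothesis is wrong for that target, so convergence is still to come and the final bound
    applies. *)
Lemma unqueried_cost j n tr t s h : j < 3 -> agree_off Z A (fam (idx v j)) ->
  play M T A f n tr t s h -> avoids Z tr -> h <> idx v j -> t < p (idx v j).
Proof.
move=> j3 ag pl av hne.
have [n' [[tr' [t' [s' [pl' lt]]]] al]] :=
  converges v0 j3 (continue_enum n (l := elts v j) isT (f_in j)).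
have pn := play_agree ag (@continue_lt f n (elts v j)) av pl.
case: (leqP n' n) => [/al[tr2 [t2 [s2 p2]]]|/ltnW le].
  by have [_ _ _ /hne] := play_det pn p2.
by have [_ le' _] := play_mono tT pn pl' le; apply: leq_ltn_trans lt.
Qed.

(* If the first query in [Z] comes too late for a target, then this target was
   already conjectured when the query was made; this cannot hold for both. *)
Lemma first_query_cost m q tau tr0 tr t s h :
  agree_off Z A (fam (idx v 1)) -> agree_off Z A (fam (idx v 2)) ->
  first_query M T A f Z m q tau tr0 tr t s h -> tau < p (idx v 2).
Proof.
move=> ag1 ag2 fq; rewrite ltnNge; apply/negP => late.
have guess j : j < 3 -> 0 < j -> agree_off Z A (fam (idx v j)) ->
    0 < m /\ forall tr' t' s' h', play M T A f m.-1 tr' t' s' h' -> h' = idx v j.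
  move=> j3 j0 ag.
  have [n [[tr' [t' [s' [pl' lt]]]] al]] :=
    converges v0 j3 (continue_enum m (l := elts v j) isT (f_in j)).
  (* Convergence at stage [m] or later would charge the query to [p (idx v j)]. Otherwise the
     hypothesis at stage [m.-1], when [Z] is still unqueried, is already [idx v j]. *)
  case: (leqP m n) => [mn|nm].
    have [tr2 [t2 [s2 [h2 [p2 _ le _]]]]] := play_before tT pl' mn.
    have lt2 := fq_cost fq ag (@continue_lt f m (elts v j)) p2.
    have : p (idx v j) <= p (idx v 2).
      by apply: leq_peval; rewrite /idx -[j == 0]negbK -lt0n j0 /= leq_add2l -ltnS.
    lia.
  split=> [|tr2 t2 s2 h2 p2]; first by lia.
  have [|tr3 [t3 [s3 p3]]] := al m.-1; first by lia.
  have mm : m.-1 < m by lia.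
  have av : avoids Z tr2.
    have /prefixP[r er] := fq_prefix fq mm p2.
    by have := fq_avoids fq; rewrite er avoids_cat => /andP[].
  have lt3 i : i < m.-1 -> f i = continue f m (elts v j) i.
    by move=> im; apply: continue_lt; lia.
  by have [_ _ _ ->] := play_det (play_agree ag lt3 av p2) p3.
have [m0 c1] := guess 1 isT isT ag1; have [_ c2] := guess 2 isT isT ag2.
have [tr2 [t2 [s2 [h2 [p2 _ _ _]]]]] := play_before tT (fq_play fq) (leq_pred m).
have := c1 _ _ _ _ p2; rewrite (c2 _ _ _ _ p2) => /idx_inj.
by case=> // _.
Qed.

End OneTarget.

(** * The contradiction inside one block *)

Section Block.
Variable W : nat.
Hypotheses (bW : base W = W) (W1 : 1 < W) (CW : prog_const M <= texp W)
  (small_cost : p (3 * 2 ^ W + 2) + 3 <= dexp W)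
  (small_top : p (3 * W + 5) + W + 3 <= 2 ^ W).

Let base_in v : W < v < 2 ^ W -> base v = W.
Proof. by move=> vW; apply: base_tower => //; lia. Qed.

Let idx_le v j : W < v < 2 ^ W -> 0 < j < 3 -> idx v j <= 3 * 2 ^ W + 2.
Proof. by move=> vW j3; rewrite /idx base_in //; case: eqP; lia. Qed.

Let dexp_ge v : W <= v -> 16 <= dexp v /\ p (3 * 2 ^ W + 2) + 3 <= dexp v.
Proof.
move=> le; have := leq_dexp le; have : dexp 2 <= dexp W by apply: leq_dexp.
by have -> : dexp 2 = 16 by []; split; lia.
Qed.

(** For [v] in the block, [{texp W}] agrees off [key v] with all three sets of [v], and [elts v 0]
    agrees off [key2 v] with the other two. *)
Definition key v : pred nat := fun q => q \in [:: texp v; top v 1; top v 2].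
Definition key2 v : pred nat := fun q => q \in [:: top v 1; top v 2].

Let k1 := idx W 0.
Let A1 := fam k1.
Let f1 : nat -> nat := fun=> texp W.

Let W0 : 0 < W. Proof. by lia. Qed.

Let A1P x : A1 x <-> x = texp W.
Proof.
rewrite /A1 /k1 fam_idx // !inE bW -texp_top.
by split=> [/or3P[] /eqP|->] //; rewrite eqxx.
Qed.

Let k1_big : texp (2 ^ W).+1 <= k1.
Proof. by rewrite /k1 /idx /uexp bW /= eqxx; lia. Qed.

Let f1_in v : W < v < 2 ^ W -> forall i, f1 i \in [:: texp (base v); texp v].
Proof. by move=> vW i; rewrite base_in // inE eqxx. Qed.

Let agree1 v j : W < v < 2 ^ W -> j < 3 -> agree_off (key v) A1 (fam (idx v j)).
Proof.
move=> vW j3 w; rewrite A1P fam_idx //; last by lia.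
rewrite /key /elts !inE base_in // !negb_or => /and3P[/negPf n0 /negPf n1 /negPf n2].
rewrite n0 /=; have -> : (w == top v j) = false.
  by move: j3; case: j => [_|[_|[_|//]]] //; rewrite -texp_top.
by rewrite orbF; split=> /eqP.
Qed.

Let agree2 v j : W < v < 2 ^ W -> 0 < j < 3 ->
  agree_off (key2 v) (fam (idx v 0)) (fam (idx v j)).
Proof.
move=> vW j3 w; rewrite !fam_idx //; try lia.
rewrite /key2 /elts !inE base_in // !negb_or => /andP[/negPf n1 /negPf n2].
have -> : (w == top v j) = false by case: j j3 => [|[|[|]]].
by rewrite -texp_top orbb orbF.
Qed.

Let agree12 v : W < v < 2 ^ W -> agree_off (key v) A1 (fam (idx v 0)).
Proof. by move=> vW; apply: agree1. Qed.

Let k1_ne v j : W < v < 2 ^ W -> j < 3 -> k1 <> idx v j.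
Proof. by move=> vW j3 /idx_inj[] // e; move: vW; rewrite e ltnn. Qed.

Let CB v : W < v < 2 ^ W -> prog_const M <= texp v.
Proof. by move=> vW; apply: leq_trans CW (leq_texp _); lia. Qed.

Let exp_mul t v : t <= dexp v -> 2 ^ t * texp v <= 2 ^ (2 * dexp v).
Proof. by move=> le; rewrite /texp -expnD leq_exp2 //; lia. Qed.

Let key2_bounds v q : key2 v q -> 2 ^ (2 * dexp v) <= q <= 2 ^ (3 * dexp v).
Proof.
by rewrite /key2 !inE /top => /orP[] /eqP->; rewrite !leq_exp2 //; lia.
Qed.

Let key_bounds v q : key v q -> texp v <= q <= 2 ^ (3 * dexp v).
Proof.
by rewrite /key !inE /top /texp => /or3P[] /eqP->; rewrite !leq_exp2 //; lia.
Qed.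

Let sum_pow y a b : a <= 2 ^ y -> b <= 2 ^ y -> a + b <= 2 ^ y.+1.
Proof. by rewrite expnS; lia. Qed.

(* Otherwise the teacher's string has become so long at stage [N] that the index
   of [{texp W, texp v}] cannot be reached cheaply any more. *)
Lemma all_keys_queried v N tr t s : W < v < 2 ^ W -> 0 < N ->
  play M T A1 f1 N tr t s k1 -> ~~ avoids (key v) tr.
Proof.
move=> vW N0 pl; apply/negP => av.
have v0 : 0 < v by lia.
have [X16 pX] := dexp_ge (ltnW (proj1 (andP vW))).
have cost_le j t' : 0 < j < 3 -> t' < p (idx v j) -> t' <= dexp v.
  move=> j3; have := leq_peval cs (idx_le vW j3); lia.
have tX : t <= dexp v.
  apply: (cost_le 1) => //; apply: (unqueried_cost v0 (f1_in vW) _ _ pl av) => //.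
    exact: agree1.
  exact: k1_ne.
have y_big : 16 * dexp v <= dexp v.+1 by rewrite dexpS leq_mul2r X16 orbT.
(* The hypothesis [k1] is at least [2 ^ dexp v.+2], which [t] steps can only reach from a long
   string. *)
have L_big : 2 ^ (dexp v.+1 + 4) < size s.
  rewrite ltnNge; apply/negP => Lz.
  have lc := play_lincomb tT CW (fun=> leqnn _) pl.
  have := leq_trans k1_big (lincomb_upper lc).
  move=> /long_input /(_ Lz); apply.
    rewrite leq_exp2 //; have : dexp W <= dexp v.+1 by apply: leq_dexp; lia.
    lia.
  have : dexp v.+2 <= dexp (2 ^ W).+1 by apply: leq_dexp; lia.
  rewrite [dexp v.+2]dexpS.
  have : dexp v.+1 * 16 <= dexp v.+1 * dexp v.+1 by rewrite leq_mul2l; lia.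
  lia.
(* A text of [{texp W, texp v}] with the same play, hence the same long string, at stage [N]. *)
pose f2 := continue f1 N [:: texp v].
have f2_in i : f2 i \in [:: texp (base v); texp v].
  rewrite /f2 /continue /= modn1 base_in //.
  by case: ifP => _; rewrite !inE eqxx ?orbT.
have f2_le i : f2 i <= texp v.
  have := f2_in i; rewrite !inE base_in // => /orP[] /eqP-> //; apply: leq_texp; lia.
have f2_enum : enumeration (fun x => x \in elts v 0) f2.
  split=> [i|x].
    by have := f2_in i; rewrite !inE => /orP[] ->; rewrite ?orbT.
  rewrite !inE -texp_top orbb base_in // => /orP[] /eqP ->.
    by exists 0; rewrite /f2 /continue N0.
  by exists N; rewrite /f2 /continue ltnn /= modn1.
have [n2 [_ /(_ (maxn n2 N) (leq_maxl _ _))[tr2 [t2 [s2 p2]]]]] :=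
  converges v0 (isT : 0 < 3) f2_enum.
have pN : play M T (fam (idx v 0)) f2 N tr t s k1.
  by apply: play_agree (agree12 vW) _ av pl => i; apply: continue_lt.
(* Rules out the second alternative of [lincomb_gap] from stage [N] on, for [idx v 0] and for the
   queries in [key2 v]. *)
have far L w t' : size s <= L -> t' <= dexp v -> w <= 2 ^ (dexp v.+1 + 3) ->
    ~ (L <= w + 2 ^ t' * texp v).
  move=> sL /exp_mul et wz; apply/negP; rewrite -ltnNge.
  apply: leq_ltn_trans (leq_trans L_big sL); rewrite addnS; apply: sum_pow => //.
  by apply: leq_trans et _; rewrite leq_exp2 //; lia.
(* Without a query in [key2 v] the learner is still cheap, but [idx v 0 = 3 * texp v.+1] lies in the
   gap. *)
case av2: (avoids (key2 v) tr2).
  have t2X : t2 <= dexp v.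
    apply: (cost_le 1) => //; apply: (unqueried_cost v0 f2_in _ _ p2 av2) => //.
      exact: agree2.
    by move=> /idx_inj[].
  have [_ _ ls] := play_mono tT pN p2 (leq_maxr _ _).
  have k2 : idx v 0 = 3 * texp v.+1.
    rewrite /idx /uexp base_in //= addn0; case: eqP => // e; lia.
  have := lincomb_gap (play_lincomb tT (CB vW) f2_le p2); rewrite k2 => -[le|].
    have := leq_trans le (exp_mul t2X); apply/negP; rewrite -ltnNge.
    apply: leq_trans (_ : texp v.+1 <= _); last by lia.
    by rewrite ltn_exp2l //; lia.
  apply: far => //; rewrite expnD /texp; lia.
have [m [q [tau [tr0 [tr' [t' [s' [h' [mn fq]]]]]]]]] := exists_first_query tT p2 (negbT av2).
have tauX : tau <= dexp v.
  apply: (cost_le 2) => //.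
  by apply: (first_query_cost v0 f2_in _ _ fq); apply: agree2.
(* Up to stage [N] nothing in [key v] was queried. So the query is made with the long string, and
   [q] lies in the gap. *)
have Nm : N <= m.
  rewrite leqNgt; apply/negP => /ltnW mN.
  have [/prefixP[r er] _ _] := play_mono tT (fq_play fq) pN mN.
  move: av; rewrite er avoids_cat => /andP[/hasPn/(_ _ (fq_in fq))/negP[]].
  by have := fq_X fq; rewrite /key /key2 !inE => ->; rewrite orbT.
have [_ _ ls] := play_mono tT pN (fq_play fq) Nm.
have /andP[q1 q2] := key2_bounds (fq_X fq).
case: (lincomb_gap (fq_lincomb fq (CB vW) f2_le)) => [le|].
  have := leq_trans q1 le; rewrite /texp -expnD leq_exp2l //.
  have := first_query_cost v0 f2_in (agree2 vW (j := 1) isT) (agree2 vW (j := 2) isT) fq.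
  have := leq_peval cs (idx_le vW (j := 2) isT); lia.
apply: far => //; apply: leq_trans q2 _; rewrite leq_exp2 //; lia.
Qed.

Lemma learner_impossible : False.
Proof.
have WW : W.+1 < 2 ^ W by lia.
(* The last [v] of the block: huge elements, but the smallest three-element indices, [idx vt 2]
   being [3 * W + 5]. *)
pose vt := (2 ^ W).-1; have vtW : W < vt < 2 ^ W by rewrite /vt; lia.
have [X16 pX] := dexp_ge (leqnn W).
have f1_enum : enumeration (fun x => x \in elts W 0) f1.
  split=> [i|x]; first by rewrite !inE bW eqxx.
  by rewrite !inE bW -texp_top => /or3P[] /eqP->; exists 0.
have [n [_ /(_ n.+1 (leqnSn n))[tr [t [s pl]]]]] := converges W0 (isT : 0 < 3) f1_enum.
have queried v vW := @all_keys_queried v _ _ _ _ vW (ltn0Sn n) pl.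
have fq1 v : W < v < 2 ^ W -> exists m q tau tr0 tr' t' s' h',
    first_query M T A1 f1 (key v) m q tau tr0 tr' t' s' h' /\ tau < p (idx v 2).
  move=> vW.
  have [m [q [tau [tr0 [tr' [t' [s' [h' [mn fq]]]]]]]]] :=
    exists_first_query tT pl (queried v vW).
  exists m, q, tau, tr0, tr', t', s', h'; split=> //.
  apply: (first_query_cost _ (f1_in vW) _ _ fq); first by lia.
    exact: agree1.
  exact: agree1.
have [mt [qt [taut [tr0 [trt [tt [st [ht [fqt taut_lt]]]]]]]]] := fq1 vt vtW.
have {}taut_lt : taut < p (3 * W + 5).
  apply: leq_trans taut_lt (leq_peval _ _).
  by rewrite /idx base_in // /vt /=; lia.
(* Pigeonhole: by [rank] a query serves only one [v], and [tr0] has at most [taut] queries, fewer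
   than the candidates below [vt]. *)
have [v [vW vlt av]] : exists v, [/\ W < v < 2 ^ W, v < vt & avoids (key v) tr0].
  pose V := iota W.+1 (vt - W.+1).
  case ha: (has (fun v => avoids (key v) tr0) V).
    have /hasP[v] := ha; rewrite mem_iota => vV av.
    by exists v; split=> //; lia.
  have : size V <= size (map rank (unzip1 tr0)).
    apply: uniq_leq_size; first exact: iota_uniq.
    move=> v vV; have := hasPn (negbT ha) v vV; rewrite negbK => /hasP[q qin kq].
    move: vV; rewrite mem_iota => vV; apply/mapP; exists q => //.
    by move: kq; rewrite /key !inE texp_top => /or3P[] /eqP->; rewrite rank_top //; lia.
  rewrite size_iota !size_map; have := fq_before fqt; rewrite /vt; lia.
have [m [q [tau [tr1 [tr' [t' [s' [h' [fq tau_lt]]]]]]]]] := fq1 v vW.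
have {}tau_lt : tau < p (3 * 2 ^ W + 2).
  by apply: leq_trans tau_lt (leq_peval _ (idx_le _ _)).
(* An earlier query of [key v] would already occur in [tr0]. *)
have mtm : mt <= m.
  rewrite leqNgt; apply/negP => lt.
  have /prefixP[r er] := fq_prefix fqt lt (fq_play fq).
  move: av; rewrite er avoids_cat => /andP[/hasPn/(_ _ (fq_in fq))/negP[]].
  exact: fq_X fq.
have [_ _ ls] := play_mono tT (fq_play fqt) (fq_play fq) mtm.
have [Xv16 pXv] := dexp_ge (ltnW (proj1 (andP vW))).
have XWv : 16 * dexp W <= dexp v.
  apply: leq_trans (_ : dexp W.+1 <= _); last by apply: leq_dexp; lia.
  by rewrite dexpS leq_mul2r X16 orbT.
have /andP[q1 q2] := key_bounds (fq_X fq).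
have eW : 2 ^ tau * texp W <= 2 ^ (2 * dexp W) by apply: exp_mul; lia.
(* [q] is too large for the small range, so the string at stage [m] is hardly longer than [q]. *)
case: (lincomb_gap (fq_lincomb fq CW (fun=> leqnn _))) => [le|le].
  have := leq_trans q1 (leq_trans le eW); rewrite leq_exp2l //; lia.
have /andP[qt1 _] := key_bounds (fq_X fqt).
have up := lincomb_upper (fq_lincomb fqt CW (fun=> leqnn _)).
(* The string at stage [mt] is no longer than that, too short for reaching [texp vt] in [taut]
   steps. *)
apply: (long_input (z := (3 * dexp v).+1) (leq_trans qt1 up)).
- apply: leq_trans ls (leq_trans le _); apply: sum_pow => //.
  by apply: leq_trans eW _; rewrite leq_exp2 //; lia.
- by rewrite leq_exp2 //; lia.
- have : dexp v.+1 <= dexp vt by apply: leq_dexp; lia.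
  rewrite dexpS; have : dexp v * 16 <= dexp v * dexp v by rewrite leq_mul2l; lia.
  have : p (3 * W + 5) <= p (3 * 2 ^ W + 2) by apply: leq_peval; lia.
  lia.
Qed.

End Block.
End LowerBound.

Lemma fam_not_PRT_TO : ~ PRT_TO fam.
Proof.
move=> [M [T [cs [tT learns]]]].
have [W [bW W1 CW h1 h2]] := good_tower cs (prog_const M).
exact: (learner_impossible tT learns bW W1 CW h1 h2).
Qed.

(** * A loop language for the machine *)

(* Registers 3 and 4 are reserved: compiled loops use them as the constants 1
   and 0. *)
Inductive cmd : Type :=
| CLoad (r c : nat)
| CAdd (r a b : nat)
| CSub (r a b : nat)
| CLoadI (r a : nat)
| CSeq (c1 c2 : cmd)
| CIf (r : nat) (c : cmd)   (* if R[r] <> 0 then c *)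
| CFor (r : nat) (c : cmd). (* while R[r] <> 0 do c; R[r] := R[r] - 1 *)

Notation "c1 ;; c2" := (CSeq c1 c2) (at level 60, right associativity).

(** The loop case repeats the writes of the compiled code to registers 3 and 4 in their order, so
    that the machine ends in exactly this register function. *)
Fixpoint den (c : cmd) (R : regs) : regs :=
  match c with
  | CLoad r k => upd R r k
  | CAdd r a b => upd R r (R a + R b)
  | CSub r a b => upd R r (R a - R b)
  | CLoadI r a => upd R r (R (R a))
  | CSeq c1 c2 => den c2 (den c1 R)
  | CIf r c => if R r == 0 then R else den c R
  | CFor r c =>
      iter (R r) (fun S => let S' := upd (den c S) 3 1 in
                           upd (upd S' r (S' r - S' 3)) 4 0) R
  end.

Fixpoint writes (c : cmd) : seq nat :=
  match c with
  | CLoad r _ | CAdd r _ _ | CSub r _ _ | CLoadI r _ => [:: r]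
  | CSeq c1 c2 => writes c1 ++ writes c2
  | CIf _ c => writes c
  | CFor r c => [:: 3, 4, r & writes c]
  end.

(** A loop counter may change only by the decrement of its own loop; then the body runs exactly
    [R r] times. *)
Fixpoint wf (c : cmd) : bool :=
  match c with
  | CSeq c1 c2 => wf c1 && wf c2
  | CIf _ c => wf c
  | CFor r c => [&& r != 3, r != 4, r \notin writes c & wf c]
  | _ => true
  end.

Fixpoint compile (o : nat) (c : cmd) : program :=
  match c with
  | CLoad r k => [:: ILoadC r k]
  | CAdd r a b => [:: IAdd r a b]
  | CSub r a b => [:: ISub r a b]
  | CLoadI r a => [:: ILoadI r a]
  | CSeq c1 c2 => let p1 := compile o c1 in p1 ++ compile (o + size p1) c2
  | CIf r c => let p1 := compile o.+1 c in IJz r (o + (size p1).+1) :: p1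
  | CFor r c => let p1 := compile o.+1 c in
      IJz r (o + (size p1).+1 + 4) :: p1 ++
      [:: ILoadC 3 1; ISub r r 3; ILoadC 4 0; IJz 4 o]
  end.

Lemma den_frame c R k : k \notin writes c -> den c R k = R k.
Proof.
elim: c R => [r x|r a b|r a b|r a|c1 IH1 c2 IH2|r c IH|r c IH] R /=.
1-4: by rewrite inE /upd => /negPf->.
- by rewrite mem_cat negb_or => /andP[k1 k2]; rewrite IH2 // IH1.
- by move=> kc; case: ifP => // _; apply: IH.
rewrite !inE !negb_or => /and4P[/negPf k3 /negPf k4 /negPf kr kc].
by elim: (R r) => //= n {}IHn; rewrite /upd k4 kr k3 IH.
Qed.

Definition code_at (p : program) o q := exists p1 p2, p = p1 ++ q ++ p2 /\ size p1 = o.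

Lemma code_at_cat p o q1 q2 :
  code_at p o (q1 ++ q2) -> code_at p o q1 /\ code_at p (o + size q1) q2.
Proof.
move=> [p1 [p2 [-> <-]]]; split; first by exists p1, (q2 ++ p2); rewrite !catA.
by exists (p1 ++ q1), p2; rewrite !catA size_cat.
Qed.

Lemma code_at_cons p o i q : code_at p o (i :: q) ->
  nth IHalt p o = i /\ code_at p o.+1 q.
Proof.
move=> [p1 [p2 [-> <-]]]; split; first by rewrite nth_cat ltnn subnn.
by exists (rcons p1 i), p2; rewrite cat_rcons size_rcons.
Qed.

Lemma compile_correct p O c o R : wf c -> code_at p o (compile o c) ->
  exists t, reach p O o R t [::] (o + size (compile o c)) (den c R).
Proof.
elim: c o R => [r x|r a b|r a b|r a|c1 IH1 c2 IH2|r c IH|r c IH] o R /=.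
- move=> _ /code_at_cons[e _]; exists 1; rewrite addn1.
  exact: reach_one (st_loadc _ _ e).
- move=> _ /code_at_cons[e _]; exists 1; rewrite addn1.
  exact: reach_one (st_add _ _ e).
- move=> _ /code_at_cons[e _]; exists 1; rewrite addn1.
  exact: reach_one (st_sub _ _ e).
- move=> _ /code_at_cons[e _]; exists 1; rewrite addn1.
  exact: reach_one (st_loadi _ _ e).
- move=> /andP[w1 w2] /code_at_cat[/(IH1 _ R w1)[t1 r1] /(IH2 _ (den c1 R) w2)[t2 r2]].
  by exists (t1 + t2); rewrite size_cat addnA; apply: reach_trans r1 r2.
- move=> wc /code_at_cons[e ca]; case: eqP => R0.
    exists 1; exact: reach_one (st_jz_t _ e R0).
  have [t rt] := IH _ R wc ca; exists t.+1; rewrite addnS -addSn.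
  exact: reach_step (st_jz_f _ e R0) rt.
move=> /and4P[r3 r4 rc wc] /code_at_cons[e /code_at_cat[ca]].
move=> /code_at_cons[e3 /code_at_cons[er /code_at_cons[e4 /code_at_cons[ej _]]]].
rewrite size_cat /=; set m := size _ in e e3 er e4 ej *.
have -> : o + (m + 4).+1 = o + m.+1 + 4 by lia.
move en : (R r) => n; elim: n R en => [|n IHn] R en.
  by exists 1; exact: reach_one (st_jz_t _ e en).
have [t1 rt1] := IH _ R wc ca.
rewrite iterSr /=; set R' := upd _ 4 0.
have [|t2 rt2] := IHn R'.
  by rewrite /R' /upd (negPf r3) (negPf r4) eqxx (den_frame R rc) en /=; lia.
exists (1 + (t1 + (1 + (1 + (1 + (1 + t2)))))).
have ne : R r <> 0 by rewrite en.
apply: (reach_trans (qs := [::]) (reach_one (st_jz_f O e ne))).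
apply: (reach_trans (qs := [::]) rt1).
apply: (reach_trans (qs := [::]) (reach_one (st_loadc _ _ e3))).
apply: (reach_trans (qs := [::]) (reach_one (st_sub _ _ er))).
apply: (reach_trans (qs := [::]) (reach_one (st_loadc _ _ e4))).
apply: (reach_trans (qs := [::]) (reach_one (st_jz_t _ ej _))) => //.
Qed.

(* init; while R[d] <> 0 do body; final *)
Definition loop_prog (init : cmd) (d : nat) (body final : cmd) : program :=
  let q0 := compile 0 init in
  let o := size q0 in
  let q1 := compile o.+1 (body ;; CLoad 4 0) in
  let o2 := o.+1 + size q1 in
  q0 ++ IJz d o2.+1 :: q1 ++ IJz 4 o :: compile o2.+1 final.

Section LoopProg.
Variables (init body final : cmd) (d : nat) (O : nat -> Prop) (R : regs).
Hypotheses (wi : wf init) (wb : wf body) (wfin : wf final).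

Let p := loop_prog init d body final.
Let o := size (compile 0 init).
Let it k := iter k (den (body ;; CLoad 4 0)) (den init R).

Let code : [/\ code_at p 0 (compile 0 init),
  nth IHalt p o = IJz d (o.+1 + size (compile o.+1 (body ;; CLoad 4 0))).+1,
  code_at p o.+1 (compile o.+1 (body ;; CLoad 4 0)),
  nth IHalt p (o.+1 + size (compile o.+1 (body ;; CLoad 4 0))) = IJz 4 o &
  code_at p (o.+1 + size (compile o.+1 (body ;; CLoad 4 0))).+1
    (compile (o.+1 + size (compile o.+1 (body ;; CLoad 4 0))).+1 final)].
Proof.
have /code_at_cat[c0] : code_at p 0 p by exists [::], [::]; rewrite cats0.
rewrite add0n => /code_at_cons[c1 /code_at_cat[c2 /code_at_cons[c3 c4]]].
by split.
Qed.

Lemma loop_prog_init : exists t, reach p O 0 R t [::] o (it 0).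
Proof. by have [c0 _ _ _ _] := code; have := compile_correct O R wi c0. Qed.

Lemma loop_prog_iter k : it k d <> 0 ->
  exists t, reach p O o (it k) t.+1 [::] o (it k.+1).
Proof.
move=> nz; have [_ c1 c2 c3 _] := code.
have w : wf (body ;; CLoad 4 0) by rewrite /= wb.
have [t rt] := compile_correct O (it k) w c2.
exists (t + 1); rewrite -addn1 addnC.
apply: (reach_trans (qs := [::]) (reach_one (st_jz_f O c1 nz))).
apply: (reach_trans (qs := [::]) rt).
by apply: reach_one; apply: st_jz_t c3 _; rewrite /= /upd eqxx.
Qed.

Lemma loop_prog_halts k : (forall i, i < k -> it i d <> 0) -> it k d = 0 ->
  exists t, exec p O 0 R t [::] (den final (it k)).
Proof.
move=> nz z; have [t0 r0] := loop_prog_init.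
have [t1 r1] : exists t, reach p O o (it 0) t [::] o (it k).
  elim: k nz {z} => [|k IH] nz; first by exists 0; apply: reach_refl.
  have [|t rt] := IH; first by move=> i ik; apply: nz; apply: ltnW.
  have [t' rt'] := loop_prog_iter (nz k (ltnSn k)).
  by exists (t + t'.+1); apply: (reach_trans (qs := [::]) rt rt').
have [_ c1 _ _ c4] := code; have [t2 r2] := compile_correct O (it k) wfin c4.
exists (t0 + (t1 + (1 + t2))); apply/execP; eexists.
  apply: (reach_trans (qs := [::]) r0); apply: (reach_trans (qs := [::]) r1).
  exact: (reach_trans (qs := [::]) (reach_one (st_jz_t _ c1 z)) r2).
have sc (i : instr) q : size (i :: q) = (size q).+1 by [].
by rewrite nth_default // /p /loop_prog -/o !(size_cat, sc); lia.
Qed.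

(** Every iteration takes at least one step, so induction on the remaining steps reaches the
    exit. *)
Lemma loop_prog_halted t qs Rf : exec p O 0 R t qs Rf -> exists k, it k d = 0.
Proof.
have [t0 r0] := loop_prog_init => /(exec_reach r0)[t1 [qs1 [_]]].
suff loop k : exec p O o (it k) t1 qs1 Rf -> exists k, it k d = 0 by exact: loop.
elim/ltn_ind: t1 k qs1 => t1 IH k qs1 e.
case: (it k d =P 0) => [z|/loop_prog_iter[t2 r2]]; first by exists k.
have [t3 [qs3 [et e3]]] := exec_reach r2 e.
by apply: IH e3; rewrite et addSn ltnS leq_addl.
Qed.

End LoopProg.

(** * Enumeration and learning of the family *)

Lemma den_seq c1 c2 R : den (c1 ;; c2) R = den c2 (den c1 R).
Proof. by []. Qed.

Lemma den_if r c R : den (CIf r c) R = if R r == 0 then R else den c R.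
Proof. by []. Qed.

Definition mov r a := CLoad 4 0 ;; CAdd r a 4.
Definition inc r := CLoad 20 1 ;; CAdd r r 20.
Definition pow2 r := CLoad 18 1 ;; CFor r (CAdd 18 18 18) ;; mov r 18.

Lemma den_mov r a R : a != 4 -> den (mov r a) R r = R a.
Proof. by move=> /negPf a4; rewrite /= /upd !eqxx a4 addn0. Qed.

Lemma den_pow2 r R : r \notin [:: 3; 4; 18] -> den (pow2 r) R r = 2 ^ R r.
Proof.
rewrite !inE !negb_or => /and3P[/negPf r3 /negPf r4 /negPf r18].
rewrite /pow2 2!den_seq den_mov // [den (CLoad 18 1) R]/=; set S := upd R 18 1.
have <- : S r = R r by rewrite /S /upd r18.
rewrite /=; elim: (S r) => // n IH.
rewrite iterS; set U := iter n _ S in IH *.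
by rewrite /upd /= [18 == r]eq_sym r18 IH addnn -mul2n expnS.
Qed.

(** Registers 1 and 2 hold the input of the search, 5 to 8 hold [v], [base v], [2 ^ base v] and [j],
    9 to 11 the elements, 12 the index, 13 [dexp v], and 19 is the flag of the search loop. *)
Definition comp_a := mov 9 6 ;; pow2 9 ;; pow2 9 ;; pow2 9.
Definition comp_dexp := mov 13 5 ;; pow2 13 ;; pow2 13.
Definition comp_b := mov 10 13 ;; pow2 10.
Definition comp_c :=
  mov 11 13 ;; mov 14 8 ;; CFor 14 (CAdd 11 11 13) ;; pow2 11.
(** [1 - (R 5 - R 6)] tests whether [v] is the base of its block; [next_v] tests for the end of the
    block in the same way. *)
Definition comp_u :=
  mov 16 5 ;; inc 16 ;; CSub 14 5 6 ;; CLoad 20 1 ;; CSub 14 20 14 ;;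
  CIf 14 (mov 16 7 ;; inc 16).
Definition comp_idx :=
  comp_u ;; pow2 16 ;; pow2 16 ;; pow2 16 ;;
  CIf 8 (CAdd 16 6 7 ;; CSub 16 16 5) ;;
  CAdd 12 16 16 ;; CAdd 12 12 16 ;; CAdd 12 12 8.
Definition next_block := CIf 15 (mov 6 7 ;; pow2 7).
Definition next_v :=
  CLoad 8 0 ;; inc 5 ;; CSub 15 7 5 ;; CLoad 20 1 ;; CSub 15 20 15.
Definition next_j := inc 8 ;; CLoad 20 2 ;; CSub 14 8 20.
Definition advance := next_j ;; CIf 14 (next_v ;; next_block).
Definition search_body (check : cmd) :=
  comp_a ;; comp_dexp ;; comp_b ;; comp_c ;; comp_idx ;; check ;; advance.

Lemma comp_aE R : den comp_a R 9 = texp (R 6).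
Proof. by rewrite /comp_a 3!den_seq !den_pow2 // den_mov. Qed.

Lemma comp_dexpE R : den comp_dexp R 13 = dexp (R 5).
Proof. by rewrite /comp_dexp 2!den_seq !den_pow2 // den_mov. Qed.

Lemma comp_bE R : den comp_b R 10 = 2 ^ R 13.
Proof. by rewrite /comp_b den_seq den_pow2 // den_mov. Qed.

Lemma comp_cE R : den comp_c R 11 = 2 ^ ((R 8).+1 * R 13).
Proof.
rewrite /comp_c 3!den_seq den_pow2 //; congr (2 ^ _).
set S := den (mov 14 8) _.
have -> : R 8 = S 14 by rewrite /S den_mov // den_frame.
have -> : R 13 = S 13 by rewrite /S !den_frame.
have S11 : S 11 = S 13 by rewrite /S !(@den_frame (mov 14 8)) // den_mov // den_frame.
rewrite /=; set F := (fun _ => _).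
suff : forall n, iter n F S 11 = n.+1 * S 13 /\ iter n F S 13 = S 13.
  by move=> /(_ (S 14))[].
elim=> [|n [IH1 IH2]] /=; first by rewrite mul1n.
by rewrite {1}/F {1}/F /upd /= IH1 IH2; split=> //; rewrite [in RHS]mulSn addnC.
Qed.

Lemma comp_uE R : R 6 <= R 5 ->
  den comp_u R 16 = if R 5 == R 6 then (R 7).+1 else (R 5).+1.
Proof.
move=> le; rewrite /= /upd /=.
case: (R 5 =P R 6) => [->|ne]; first by rewrite subnn /= !addn0 addn1.
have -> : 1 - (R 5 - R 6) = 0 by lia.
by rewrite /= !addn0 addn1.
Qed.

Lemma comp_idxE R : R 6 <= R 5 ->
  den comp_idx R 12 = 3 * (if R 8 == 0 then texp (if R 5 == R 6 then (R 7).+1 else (R 5).+1)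
     else R 6 + R 7 - R 5) + R 8.
Proof.
move=> le; rewrite /comp_idx 7!den_seq.
set S := den (pow2 16) (den (pow2 16) (den (pow2 16) _)).
have fr k : k \in [:: 5; 6; 7; 8] -> S k = R k.
  by rewrite !inE => /or4P[] /eqP->; rewrite /S !den_frame.
have S16 : S 16 = texp (if R 5 == R 6 then (R 7).+1 else (R 5).+1).
  by rewrite /S !den_pow2 // comp_uE.
have [S5 S6 S7 S8] := And4 (fr 5 isT) (fr 6 isT) (fr 7 isT) (fr 8 isT).
clearbody S; rewrite den_if S8; case: eqP => [R8|ne].
  by rewrite /= /upd /= S16 S8 R8; lia.
by rewrite /= /upd /= S5 S6 S7 S8; lia.
Qed.

Lemma advanceE R v j : R 5 = v -> R 6 = base v -> R 7 = 2 ^ base v -> R 8 = j -> j < 3 ->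
  let R' := den advance R in
  let v' := if j == 2 then v.+1 else v in
  [/\ R' 5 = v', R' 6 = base v', R' 7 = 2 ^ base v' & R' 8 = if j == 2 then 0 else j.+1].
Proof.
move=> R5 R6 R7 R8 j3 R' v'; have bv := base_bounds v.
rewrite /R' /advance den_seq; set U := den next_j R.
have [U5 U6 U7 U8] : [/\ U 5 = v, U 6 = base v, U 7 = 2 ^ base v & U 8 = j.+1].
  by split=> //=; rewrite /U /= /upd /= R8 addn1.
have U14 : U 14 = j.+1 - 2 by rewrite /U /= /upd /= R8 addn1.
rewrite den_if U14.
case: (j =P 2) => j2; rewrite /v' ?j2; last first.
  have -> : j.+1 - 2 == 0 by lia.
  by case: (j =P 2) => // _; split.
rewrite (_ : (3 - 2 == 0) = false) // eqxx den_seq.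
clearbody U; set V := den next_v U.
have [V5 V6 V7 V8] : [/\ V 5 = v.+1, V 6 = base v, V 7 = 2 ^ base v & V 8 = 0].
  by split=> //=; rewrite /V /= /upd /= U5 addn1.
have V15 : V 15 = 1 - (2 ^ base v - v.+1) by rewrite /V /= /upd /= U5 U7 addn1.
clearbody V; rewrite /next_block den_if V15 den_seq.
rewrite (_ : base v.+1 = if v.+1 == 2 ^ base v then v.+1 else base v) //.
case: (v.+1 =P 2 ^ base v) => [e|ne].
  have -> : (1 - (2 ^ base v - v.+1) == 0) = false by lia.
  split; rewrite ?den_pow2 ?(@den_frame (pow2 7)) //.
  - by rewrite den_mov // V7 e.
  - by rewrite den_frame // V7 -e.
have -> : 1 - (2 ^ base v - v.+1) == 0 by lia.
by split.
Qed.

Definition reg_state R v j :=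
  [/\ R 5 = v, R 6 = base v, R 7 = 2 ^ base v & R 8 = j].

Definition reg_data U v j :=
  [/\ U 9 = texp (base v), U 10 = texp v, U 11 = top v j & U 12 = idx v j].

Lemma search_bodyE check R v j :
  all (fun k => k \notin writes check) [:: 1; 2; 5; 6; 7; 8; 12] ->
  reg_state R v j -> j < 3 ->
  let R' := den (search_body check ;; CLoad 4 0) R in
  [/\ reg_state R' (if j == 2 then v.+1 else v) (if j == 2 then 0 else j.+1),
    R' 12 = idx v j, R' 1 = R 1, R' 2 = R 2 &
    exists U, [/\ reg_data U v j, U 1 = R 1, U 2 = R 2 & R' 19 = den check U 19]].
Proof.
move=> /and5P[c1 c2 c5 c6 /and4P[c7 c8 c12 _]] [R5 R6 R7 R8] j3 R'.
rewrite {}/R' /search_body 7!den_seq.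
set R1 := den comp_a R; set R2 := den comp_dexp R1; set R3 := den comp_b R2.
set R4 := den comp_c R3; set U := den comp_idx R4; set C := den check U.
have fU k : k \in [:: 1; 2; 5; 6; 7; 8] -> U k = R k.
  rewrite !inE => kin; rewrite /U /R4 /R3 /R2 /R1.
  by do 5?[case/orP: kin => [/eqP->|kin]; first by rewrite !den_frame];
    move/eqP: kin => ->; rewrite !den_frame.
have dU : reg_data U v j.
  have f4 k : k \in [:: 5; 6; 7; 8] -> R4 k = R k.
    by rewrite !inE /R4 /R3 /R2 /R1 => /or4P[] /eqP->; rewrite !den_frame.
  have R13 : R2 13 = dexp v by rewrite /R2 comp_dexpE /R1 den_frame // R5.
  split; rewrite /U.
  - by rewrite den_frame // /R4 den_frame // /R3 den_frame // /R2 den_frame // /R1 comp_aE R6.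
  - by rewrite den_frame // /R4 den_frame // /R3 comp_bE R13.
  - rewrite den_frame // /R4 comp_cE [R3 13]den_frame // R13.
    by rewrite [R3 8]den_frame // /R2 /R1 !den_frame // R8.
  - have /andP[le _] := base_bounds v.
    by rewrite comp_idxE !f4 // ?R5 ?R6 ?R7 ?R8 // /idx /uexp; case: ifP.
have C5 : C 5 = v by rewrite /C den_frame // fU.
have C6 : C 6 = base v by rewrite /C den_frame // fU.
have C7 : C 7 = 2 ^ base v by rewrite /C den_frame // fU.
have C8 : C 8 = j by rewrite /C den_frame // fU.
have [A5 A6 A7 A8] := advanceE C5 C6 C7 C8 j3.
have fA k : k \in [:: 1; 2; 12; 19] -> den advance C k = C k.
  by rewrite !inE => /or4P[] /eqP->; rewrite den_frame.
set S := den advance C in A5 A6 A7 A8 fA *.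
have fS k : k != 4 -> den (CLoad 4 0) S k = S k.
  by move=> k4; rewrite den_frame // inE.
have [_ _ _ U12] := dU.
have CU k : k \notin writes check -> C k = U k by exact: den_frame.
split; first by split; rewrite fS.
- by rewrite fS // fA // CU.
- by rewrite fS // fA // CU // fU.
- by rewrite fS // fA // CU // fU.
- by exists U; split=> //; rewrite ?fU // fS // fA.
Qed.

(** * Unbounded search through the family *)

Section Search.
Variables (prep check final : cmd) (D : nat -> nat -> nat -> nat -> Prop).
Hypotheses (wp : wf prep) (wc : wf check).
Hypothesis check_writes :
  all (fun k => k \notin writes check) [:: 1; 2; 5; 6; 7; 8; 12].
Hypothesis checkE : forall U v j, reg_data U v j ->
  (den check U 19 = 0 <-> D (U 1) (U 2) v j).

Definition search_init :=
  prep ;; CLoad 5 1 ;; CLoad 6 1 ;; CLoad 7 2 ;; CLoad 8 0 ;; CLoad 19 1.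
Definition search_prog := loop_prog search_init 19 (search_body check) final.

Variables (O : nat -> Prop) (R : regs).
Let y := den prep R 1.
Let x := den prep R 2.
(** Round [k] checks the pair [(k %/ 3).+1], [k %% 3]. Its results in registers 12 and 19 are read
    after the round, when registers 5 to 8 already hold the next pair. *)
Let it k := iter k (den (search_body check ;; CLoad 4 0)) (den search_init R).

Let itE k :
  [/\ reg_state (it k) (k %/ 3).+1 (k %% 3), it k 1 = y & it k 2 = x] /\
  it k.+1 12 = idx (k %/ 3).+1 (k %% 3) /\
  (it k.+1 19 = 0 <-> D y x (k %/ 3).+1 (k %% 3)).
Proof.
have step S n : reg_state S (n %/ 3).+1 (n %% 3) -> S 1 = y -> S 2 = x ->
  let S' := den (search_body check ;; CLoad 4 0) S in
  [/\ reg_state S' (n.+1 %/ 3).+1 (n.+1 %% 3), S' 1 = y, S' 2 = x,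
     S' 12 = idx (n %/ 3).+1 (n %% 3) & (S' 19 = 0 <-> D y x (n %/ 3).+1 (n %% 3))].
  move=> st S1 S2 S'; rewrite {}/S'.
  have [st' S12 e1 e2 [U [dU U1 U2 S19]]] :=
    search_bodyE check_writes st (ltn_pmod n (isT : 0 < 3)).
  split=> //; rewrite ?e1 ?e2 //; last by rewrite S19 (checkE dU) U1 U2 S1 S2.
  have [-> ->] : (n.+1 %/ 3).+1 = (if n %% 3 == 2 then (n %/ 3).+2 else (n %/ 3).+1)
    /\ n.+1 %% 3 = (if n %% 3 == 2 then 0 else (n %% 3).+1) by case: eqP; lia.
  exact: st'.
suff st : [/\ reg_state (it k) (k %/ 3).+1 (k %% 3), it k 1 = y & it k 2 = x].
  by case: (st) => st' s1 s2; have [_ _ _ ? ?] := step _ _ st' s1 s2.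
elim: k => [|k [st s1 s2]]; last by have [] := step _ _ st s1 s2.
by [].
Qed.

Lemma search_sound t qs Rf : exec search_prog O 0 R t qs Rf ->
  exists v j, [/\ 0 < v, j < 3 & D y x v j].
Proof.
have wi : wf search_init by rewrite /= wp.
have wb : wf (search_body check) by rewrite /= wc.
move=> e; have [k] := loop_prog_halted wi wb e; rewrite -/(it k); case: k => // k.
move=> /(proj2 (proj2 (itE k))) Dk; exists (k %/ 3).+1, (k %% 3).
by rewrite ltn_mod.
Qed.

Hypothesis wfin : wf final.

Lemma search_complete v j : 0 < v -> j < 3 -> D y x v j ->
  exists v' j' S t, [/\ 0 < v', j' < 3, D y x v' j', S 12 = idx v' j' &
    exec search_prog O 0 R t [::] (den final S)].
Proof.
move=> v0 j3 Dvj.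
have wi : wf search_init by rewrite /= wp.
have wb : wf (search_body check) by rewrite /= wc.
have ex : exists k, it k 19 == 0.
  exists (3 * v.-1 + j).+1; apply/eqP/(proj2 (proj2 (itE _))).
  have -> : (3 * v.-1 + j) %/ 3 = v.-1 by lia.
  have -> : (3 * v.-1 + j) %% 3 = j by lia.
  by rewrite prednK.
case: (ex_minnP ex) => k /eqP z mink.
have [|t e] := loop_prog_halts (d := 19) O wi wb wfin _ z.
  by move=> i ik /eqP/mink; rewrite leqNgt ik.
case: k z {mink} e => // k z e.
exists (k %/ 3).+1, (k %% 3), (it k.+1), t; have [_ [i12 i19]] := itE k.
by split; rewrite ?ltn_mod //; apply/i19.
Qed.

End Search.

Definition dist r a b := CSub r a b ;; CSub 20 b a ;; CAdd r r 20.

Definition set_min r a := CSub 20 r a ;; CSub r r 20.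

(** The flag becomes the distance from the first input to [idx v j] plus the least distance from the
    second input to an element. *)
Definition member_check :=
  dist 19 1 12 ;; dist 14 2 9 ;; dist 15 2 10 ;; set_min 14 15 ;;
  dist 15 2 11 ;; set_min 14 15 ;; CAdd 19 19 14.

Lemma member_checkE U v j : reg_data U v j ->
  (den member_check U 19 = 0 <-> (U 1 = idx v j /\ U 2 \in elts v j)).
Proof.
move=> [U9 U10 U11 U12]; rewrite !inE -U9 -U10 -U11 -U12 /member_check 6!den_seq.
set R1 := den (dist 19 1 12) U; set R2 := den (dist 14 2 9) R1.
set R3 := den (dist 15 2 10) R2; set R4 := den (set_min 14 15) R3.
set R5 := den (dist 15 2 11) R4; set R6 := den (set_min 14 15) R5.
have -> : den (CAdd 19 19 14) R6 19 = R6 19 + R6 14 by [].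
have -> : R6 19 = (U 1 - U 12) + (U 12 - U 1) by [].
have R2E : R2 14 = (U 2 - U 9) + (U 9 - U 2) by [].
have R3E : R3 15 = (U 2 - U 10) + (U 10 - U 2) by [].
have R5E : R5 15 = (U 2 - U 11) + (U 11 - U 2) by [].
have -> : R6 14 = minn (minn (R2 14) (R3 15)) (R5 15) by rewrite !minnE.
rewrite R2E R3E R5E; clear; split=> [z|[e1]]; first by split; lia.
by case/or3P=> /eqP; lia.
Qed.

Lemma fam_indexed : indexed_family fam.
Proof.
pose D n x v j := n = idx v j /\ x \in elts v j.
exists (search_prog (CLoad 4 0) member_check (CLoad 4 0)) => n x; split.
  move=> [v [j [v0 j3 en xe]]].
  have [_ [_ [S [t [_ _ _ _ e]]]]] := search_complete (prep := CLoad 4 0)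
    (check := member_check) (D := D) (R := init_regs [:: n; x]) isT isT isT member_checkE
    no_oracle (isT : wf (CLoad 4 0)) v0 j3 (conj en xe).
  by exists t, [::]; eexists; exact: e.
move=> [t [qs [Rf e]]].
have [v [j [v0 j3 [en xe]]]] := search_sound (prep := CLoad 4 0)
  (check := member_check) (D := D) isT isT isT member_checkE e.
by exists v, j.
Qed.

(* [max a b] is computed as [a + (b - a)].  The entries in registers 2, 3 and 4
   are absorbed first, because the loop uses these registers as scratch space. *)
Definition max_input :=
  CSub 2 2 1 ;; CAdd 1 1 2 ;; CSub 3 3 1 ;; CAdd 1 1 3 ;; CSub 4 4 1 ;; CAdd 1 1 4 ;;
  CLoad 3 1 ;; CFor 0 (CLoadI 2 0 ;; CSub 2 2 1 ;; CAdd 1 1 2).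

Lemma max_inputE s y : 0 < y -> y \in s -> (forall x, x \in s -> x <= y) ->
  den max_input (init_regs s) 1 = y.
Proof.
move=> y0 ys le; set I := init_regs s.
have Ile i : 0 < i -> I i <= y.
  rewrite /I /init_regs; case: i => //= i _; case: (ltnP i (size s)) => [lt|ge].
    by apply/le/mem_nth.
  by rewrite nth_default.
have [i0 i0s Ii0] : exists2 i, 0 < i <= size s & I i = y.
  exists (index y s).+1; first by rewrite /= index_mem.
  by rewrite /I /init_regs /= nth_index.
rewrite /max_input 7!den_seq.
set S := den (CLoad 3 1) _.
have S0 : S 0 = size s by [].
have S1 : S 1 = maxn (maxn (I 1) (I 2)) (maxn (I 3) (I 4)).
  by rewrite /S /= /upd /=; lia.
have Sle i : 0 < i -> S i <= y.
  have := Ile 1 isT; have := Ile 2 isT; have := Ile 3 isT; have := Ile 4 isT.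
  case: i => [|[|[|[|[|i]]]]] //; rewrite ?S1; try (rewrite /S /= /upd /=; lia).
  by rewrite -[S _]/(I _) => _ _ _ _ _; apply: Ile.
have S5 i : 5 <= i -> S i = I i by case: i => [|[|[|[|[|i]]]]].
have Smax : S 1 = y \/ exists2 i, 5 <= i <= size s & I i = y.
  case: (leqP 5 i0) => [i5|]; first by right; exists i0 => //; lia.
  have := Ile 1 isT; have := Ile 2 isT; have := Ile 3 isT; have := Ile 4 isT.
  by case: i0 i0s Ii0 => [|[|[|[|[|i0]]]]] // _ e *; left; rewrite S1; lia.
clearbody S; rewrite [den _ _]/= S0.
set F := (fun _ => _).
(* Invariant: [y] is in register 1 or in an unread register from 5 on. Reading the scratch registers
   does no harm, since they stay at most [y]; register 3 holds [1], whence [0 < y]. *)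
suff : forall n, n <= size s -> let U := iter n F S in
  [/\ U 0 = size s - n, forall i, 0 < i -> U i <= y, forall i, 5 <= i -> U i = I i &
    U 1 = y \/ exists2 i, 5 <= i <= size s - n & I i = y].
  move=> /(_ _ (leqnn _))[_ _ _ []] //.
  by rewrite subnn => -[i]; lia.
elim=> [|n IH] ns; first by rewrite subn0; split.
have /= := IH (ltnW ns); set U := iter n F S => -[U0 Ule U5 Umax]; set V := F U.
have p0 : 0 < U 0 by rewrite U0 subn_gt0.
clearbody U.
have e1 : V 1 = maxn (U 1) (U (U 0)) by rewrite /V /F /upd /=; lia.
have Vle : V 1 <= y by rewrite e1 geq_max !Ule.
split.
- by rewrite /V /F /upd /= U0; lia.
- case=> [|[|[|[|[|i]]]]] // _; rewrite /V /F /upd //=.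
  + by have := Ule _ p0; lia.
  + exact: Ule.
- by case=> [|[|[|[|[|i]]]]] // i5; rewrite /V /F /upd /= U5.
case: Umax => [U1|[i /andP[i5 iU] Iy]].
  by left; apply/eqP; rewrite eqn_leq Vle e1 U1 leq_maxl.
case: (i =P U 0) => [ei|ne].
  left; apply/eqP; rewrite eqn_leq Vle e1 -ei (U5 i) //.
  by rewrite Iy leq_maxr.
right; exists i => //; rewrite i5 /=; move: iU ne; rewrite U0; lia.
Qed.

(** The learner searches for the pair whose largest element is the maximum of the data. It is right
    once the maximum of the target has appeared, and three elements stay below the constant
    polynomial [4]. *)
Lemma fam_PSD : PSD fam.
Proof.
pose D y (x : nat) v j := y = top v j.
have checkE U v j : reg_data U v j -> (den (dist 19 1 11) U 19 = 0 <-> D (U 1) (U 2) v j).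
  by move=> [_ _ U11 _]; rewrite /D -U11 /= /upd /=; split; lia.
exists (search_prog max_input (dist 19 1 11) (mov 0 12)), [:: 4] => k f _ [fin onto].
have [v [j [v0 j3 ek _]]] := fin 0; subst k.
have [n0 fn0] : exists n, f n = top v j by apply/onto/fam_idx/top_elts.
have out m : n0 < m -> learner_out (search_prog max_input (dist 19 1 11) (mov 0 12))
    (restr f m) (idx v j).
  move=> nm; have y0 : 0 < top v j by rewrite expn_gt0.
  have ys : top v j \in restr f m by rewrite -fn0; apply: map_f; rewrite mem_iota.
  have le x : x \in restr f m -> x <= top v j.
    by move=> /mem_restr[i _ ->]; apply/elts_le_top/(fam_idx _ v0 j3).
  have ey := max_inputE y0 ys le.
  have [v' [j' [S [t [v0' j3' /esym De S12 e]]]]] := search_complete (prep := max_input)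
    (check := dist 19 1 11) (D := D) (R := init_regs (restr f m)) isT isT isT checkE
    no_oracle (isT : wf (mov 0 12)) v0 j3 ey.
  exists t, [::], (den (mov 0 12) S); split; first exact: e.
  rewrite den_mov // S12; move: De; rewrite ey => /top_inj[] // -> -> //.
exists n0.+1, (idx v j); split; last first.
  by split; [exact: out | split=> // m; exact: out].
have -> : peval [:: 4] (idx v j) = 4 by rewrite /peval /= muln0.
apply: (@uniq_leq_size _ _ (elts v j)); first exact: undup_uniq.
by move=> x; rewrite mem_undup => /mem_restr[i _ ->]; apply/fam_idx.
Qed.

Theorem theorem4p7 :
  exists F : ifamily, indexed_family F /\ PSD F /\ ~ PRT_TO F.
Proof.
by exists fam; split; [exact: fam_indexed | split; [exact: fam_PSD | exact: fam_not_PRT_TO]].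
Qed.
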